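(* Let $\mathcal{F}$ be a class of computable functions, and let $S$ be a class of $\mathcal{L}_{\mathcal{F}}$-sentences such that for every $\varphi\in S$ the terms in $\varphi_{[0,1]}$ are computable in a complexity class $\mathsf{C}$ with $\mathsf{P}_{\mathsf{C}[0,1]}\subseteq\mathsf{C}\subseteq\mathsf{PSPACE}_{\mathsf{C}[0,1]}$. Then for any $\delta\in\mathbb{Q}^+$, the $\delta$-decision problem for bounded $\Sigma_n$-sentences in $S$ is in $(\Sigma_n^{\mathsf{P}})^{\mathsf{C}}$.
   Context: A function $f:\subseteq\mathbb{R}^n\to\mathbb{R}$ is (Type 2) computable if there is a function-oracle Turing machine $M$ outputting dyadic rationals such that for every $\vec x\in\mathrm{dom}(f)$, every name $\gamma$ of $\vec x$ (a map $\gamma:\mathbb{N}\to\mathbb{D}$, $\mathbb{D}$ the dyadic rationals, with $|\gamma(i)-x|<2^{-i}$ for all $i$, componentwise for vectors) and every $i$, $|M^{\gamma}(i)-f(\vec x)|<2^{-i}$. $\mathcal{F}$ is a collection of function symbols, each denoting a Type 2 computable real function (constants are $0$-ary functions), containing at least $0$, unary negation, addition, absolute value, and all rational constants. $\mathcal{L}_{\mathcal{F}}$ has signature $\langle\mathcal{F},>\rangle$, interpreted over $\mathbb{R}$. Terms are variables and $f(t_1,\dots,t_n)$, $f\in\mathcal{F}$. Formulas: $t>0$, $t\ge0$, $\wedge$, $\vee$, $\exists$, $\forall$; $s\le t$ abbreviates $t-s\ge0$. Bounded quantifiers: $\exists^{[u,v]}x.\varphi:=\exists x.(u\le x\wedge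 x\le v\wedge\varphi)$, $\forall^{[u,v]}x.\varphi:=\forall x.((u\le x\wedge x\le v)\rightarrow\varphi)$, with $u,v$ terms whose variables are among the free variables of $\varphi$ other than $x$. A bounded $\mathcal{L}_{\mathcal{F}}$-sentence is $Q_1^{[u_1,v_1]}x_1\cdots Q_n^{[u_n,v_n]}x_n.\psi$ with $\psi$ a positive Boolean combination of atoms $t_1>0,\dots,t_k>0,t_{k+1}\ge0,\dots,t_m\ge0$; it is $\Sigma_n$ if its prefix has $n$ alternating quantifier blocks starting with $\exists$. For such $\varphi$, $\varphi_{[0,1]}$ is $Q_1^{[0,1]}x_1\cdots Q_n^{[0,1]}x_n.\psi[x_i/(u_i+(v_i-u_i)x_i)]$. The $\delta$-strengthening $\varphi^{+\delta}$ replaces each atom $t_i>0$ by $t_i>\delta$ and $t_j\ge0$ by $t_j\ge\delta$. The $\delta$-decision problem: given $\varphi$, output ''True'' or ''$\delta$-False'', where ''True'' may be output only if $\varphi$ is true and ''$\delta$-False'' only if $\varphi^{+\delta}$ is false. A representation of $f:[0,1]^n\to\mathbb{R}$ is a pair $(m_f,\theta_f)$ with $m_f:\mathbb{N}\to\mathbb{N}$ a uniform modulus of continuity on $[0,1]^n$ (i.e. $\|\vec x-\vec y\|<2^{-m_f(i)}$ implies $|f(\vec x)-f(\vec y)|<2^{-i}$) and $\theta_f:(\mathbb{D}\cap[0,1])^n\times\mathbb{N}\to\mathbb{D}$ with $|\theta_f(d,i)-f(d)|\le2^{-i}$. $f\in\mathsf{P}_{\mathsf{C}[0,1]}$ (resp.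 $\mathsf{PSPACE}_{\mathsf{C}[0,1]}$) iff it has a representation with $m_f$ a polynomial and $\theta_f(d,i)$ computable in time (resp. space) $O((\mathrm{len}(d)+i)^k)$ for some constant $k$. $(\Sigma_n^{\mathsf{P}})^{\mathsf{C}}$ denotes the $n$-th level $\Sigma_n^{\mathsf{P}}$ of the polynomial hierarchy relativized to $\mathsf{C}$.
   Formalization: The terms of φ_[0,1] are assumed computable in C uniformly in φ∈S (with φ as part of the input), and each quantifier bound [u,v] is assumed to be defined with u≤v over the range of the earlier variables; without either assumption the claim as literally stated fails. *)

(* Defs.v *)
From HB Require Import structures.
From mathcomp Require Import all_boot all_order all_algebra.
From mathcomp Require Import reals.

Set Implicit Arguments.
Unset Strict Implicit.
Unset Printing Implicit Defensive.

Import Order.TTheory GRing.Theory Num.Theory.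
Local Open Scope ring_scope.

Definition word := seq bool.

(* Prefix-free code of a word: every bit is announced by [true]. *)
Definition sd (w : word) : word :=
  flatten [seq [:: true; b] | b <- w] ++ [:: false].

Definition enc_words (ws : seq word) : word := flatten (map sd ws).

Definition nat_bits (n : nat) : word :=
  [seq odd (n %/ 2 ^ i)%N | i <- iota 0 (trunc_log 2 n).+1].

Definition enc_rat (q : rat) : word :=
  (numq q < 0) :: sd (nat_bits `|numq q|%N) ++ sd (nat_bits `|denq q|%N).

(* Signed finite binary expansions, most significant digit first; the integer
   part carries no leading zero. *)
Record dyadic := Dyadic {
  dneg : bool;
  dint : word;
  dfrac : word;
  dint_canonical : head true dint }.

Definition dval (R : realType) (d : dyadic) : R :=
  (-1) ^+ dneg d
  * (foldl (fun a (b : bool) => a.*2 + b)%N 0%N (dint d ++ dfrac d))%:R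
  / 2 ^+ size (dfrac d).

Definition enc_dyadic (d : dyadic) : word :=
  dneg d :: sd (dint d) ++ sd (dfrac d).

Definition enc_dyadics (ds : seq dyadic) : word := flatten (map enc_dyadic ds).

(* Tape symbols: the blank [None], the two bits, and auxiliary symbols. *)
Definition sym (X : finType) := option (bool + X).

Variant direction := MoveL | MoveR | Stay.

(* A two-way infinite tape: the cells left of the head, nearest first, and the
   cells from the head rightwards; all other cells are blank. *)
Record tape (X : finType) := Tape { tleft : seq (sym X); tright : seq (sym X) }.

Definition tread (X : finType) (t : tape X) : sym X := head None (tright t).

Definition twrite (X : finType) (a : sym X) (t : tape X) : tape X :=
  Tape (tleft t) (a :: behead (tright t)).

Definition tmove (X : finType) (m : direction) (t : tape X) : tape X :=
  match m with
  | MoveL => Tape (behead (tleft t)) (head None (tleft t) :: tright t)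
  | MoveR => Tape (tread t :: tleft t) (behead (tright t))
  | Stay => t
  end.

Definition tsize (X : finType) (t : tape X) : nat :=
  (size (tleft t) + size (tright t))%N.

Definition tape_of (X : finType) (w : word) : tape X :=
  Tape [::] [seq Some (inl b) | b <- w].

Fixpoint bits_of (X : finType) (s : seq (sym X)) : word :=
  if s is Some (inl b) :: s' then b :: bits_of s' else [::].

Definition tword (X : finType) (t : tape X) : word := bits_of (tright t).

(* Tape 0 is the input and output tape, tape 1 the query tape and tape 2 the
   answer tape. *)
Record machine := Machine {
  state : finType;
  extra : finType;
  ntapes : nat;
  start : state;
  halting : pred state;
  querying : pred state;
  delta : state -> {ffun 'I_ntapes.+3 -> sym extra} ->
          state * ('I_ntapes.+3 -> sym extra * direction);
  resume : state -> state }.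

Definition config (M : machine) : Type :=
  (state M * {ffun 'I_(ntapes M).+3 -> tape (extra M)})%type.

Definition init (M : machine) (w : word) : config M :=
  (start M, [ffun i => if i == ord0 then tape_of _ w else tape_of _ [::]]).

(* In a querying state the word found from the head rightwards on the query
   tape is replaced, in one step, by the oracle's answer on the answer tape. *)
Definition step (M : machine) (O : word -> word) (c : config M) : config M :=
  let: (q, ts) := c in
  if halting q then c
  else if querying q then
    (resume q,
     [ffun i => if val i == 1%N then tape_of _ [::]
                else if val i == 2%N then tape_of _ (O (tword (ts (inord 1))))
                else ts i])
  else
    let: (q', act) := delta q [ffun i => tread (ts i)] in
    (q', [ffun i => tmove (act i).2 (twrite (act i).1 (ts i))]).

Definition run (M : machine) (O : word -> word) (w : word) (t : nat) :
  config M := iter t (@step M O) (init M w).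

Definition output (M : machine) (c : config M) : word := tword (c.2 ord0).

Definition space (M : machine) (c : config M) : nat :=
  (\sum_i tsize (c.2 i))%N.

Definition outputs_within (M : machine) (O : word -> word) (w y : word)
  (t : nat) : Prop :=
  halting (run M O w t).1 /\ output (run M O w t) = y.

Definition oracle_free (M : machine) : Prop :=
  forall q : state M, ~~ querying q.

Definition no_oracle : word -> word := fun _ => [::].

Definition computes_in_time (M : machine) (w y : word) (b : nat) : Prop :=
  oracle_free M /\ outputs_within M no_oracle w y b.

Definition computes_in_space (M : machine) (w y : word) (b : nat) : Prop :=
  oracle_free M /\
  exists2 t, outputs_within M no_oracle w y t &
    forall s, (s <= t)%N -> (space (run M no_oracle w s) <= b)%N.

Definition pfun (R : realType) (n : nat) := n.-tuple R -> option R.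

Definition is_name (R : realType) (n : nat) (g : nat -> n.-tuple dyadic)
  (x : n.-tuple R) : Prop :=
  forall i (l : 'I_n), `|dval R (tnth (g i) l) - tnth x l| < 2 ^- i.

(* A natural number is passed to an oracle or to a machine in unary. *)
Definition name_oracle (n : nat) (g : nat -> n.-tuple dyadic) (w : word) :
  word := enc_dyadics (g (size w)).

Definition type2_computable (R : realType) (n : nat) (f : pfun R n) : Prop :=
  exists M : machine,
    forall (x : n.-tuple R) (y : R), f x = Some y ->
    forall g : nat -> n.-tuple dyadic, is_name g x ->
    forall i : nat, exists (t : nat) (d : dyadic),
      outputs_within M (name_oracle g) (nseq i true) (enc_dyadic d) t /\
      `|dval R d - y| < 2 ^- i.

(* The function symbols are those of [fsym] together with the basic ones that
   are built into [term] below.  The injective [fname] is how a symbol is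
   written in the input of a decision problem. *)
Record signature (R : realType) := Signature {
  fsym : Type;
  arity : fsym -> nat;
  interp : forall f : fsym, pfun R (arity f);
  fname : fsym -> word;
  fname_inj : injective fname }.

Definition computable_signature (R : realType) (F : signature R) : Prop :=
  forall f : fsym F, type2_computable (@interp R F f).

Inductive term (R : realType) (F : signature R) : Type :=
| Var of nat
| Cst of rat
| Opp of term F
| Add of term F & term F
| Abs of term F
| App (f : fsym F) of ('I_(arity f) -> term F).

Arguments Var {R F}.
Arguments Cst {R F}.

(* The value of a term is undefined as soon as that of a subterm is; the
   variable [i] denotes the [i]-th entry of [e]. *)
Fixpoint eval (R : realType) (F : signature R) (e : seq R) (t : term F) :
  option R :=
  match t with
  | Var i => onth e i
  | Cst q => Some (ratr q)
  | Opp s => omap (fun a => - a) (eval e s)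
  | Add s1 s2 =>
      if (eval e s1, eval e s2) is (Some a, Some b) then Some (a + b) else None
  | Abs s => omap (fun a => `|a|) (eval e s)
  | App f args =>
      if [forall i, eval e (args i)] then
        @interp R F f [tuple odflt 0 (eval e (args i)) | i < arity f]
      else None
  end.

Fixpoint vars_below (R : realType) (F : signature R) (n : nat) (t : term F) :
  bool :=
  match t with
  | Var i => (i < n)%N
  | Cst _ => true
  | Opp s | Abs s => vars_below n s
  | Add s1 s2 => vars_below n s1 && vars_below n s2
  | App f args => [forall i, vars_below n (args i)]
  end.

Inductive matrix_form (R : realType) (F : signature R) : Type :=
| Gt0 of term F
| Ge0 of term F
| And of matrix_form F & matrix_form F
| Or of matrix_form F & matrix_form F.

Fixpoint atoms (R : realType) (F : signature R) (psi : matrix_form F) :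
  seq (term F) :=
  match psi with
  | Gt0 t | Ge0 t => [:: t]
  | And p1 p2 | Or p1 p2 => atoms p1 ++ atoms p2
  end.

Fixpoint matrix_holds (R : realType) (F : signature R) (e : seq R)
  (psi : matrix_form F) : Prop :=
  match psi with
  | Gt0 t => exists2 a, eval e t = Some a & 0 < a
  | Ge0 t => exists2 a, eval e t = Some a & 0 <= a
  | And p1 p2 => matrix_holds e p1 /\ matrix_holds e p2
  | Or p1 p2 => matrix_holds e p1 \/ matrix_holds e p2
  end.

(* A bounded quantifier; [qex] is [true] for an existential one. *)
Record bquant (R : realType) (F : signature R) :=
  BQuant { qex : bool; qlo : term F; qhi : term F }.

(* The [i]-th quantifier of the prefix binds the variable [i]. *)
Record sentence (R : realType) (F : signature R) :=
  Sentence { qprefix : seq (bquant F); matrix_of : matrix_form F }.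

Definition in_bounds (R : realType) (F : signature R) (e : seq R)
  (Q : bquant F) (x : R) : Prop :=
  exists a b, [/\ eval e (qlo Q) = Some a, eval e (qhi Q) = Some b &
                  a <= x <= b].

Fixpoint prefix_holds (R : realType) (F : signature R) (qs : seq (bquant F))
  (psi : matrix_form F) (e : seq R) : Prop :=
  if qs is Q :: qs' then
    if qex Q then exists2 x, in_bounds e Q x & prefix_holds qs' psi (rcons e x)
    else forall x, in_bounds e Q x -> prefix_holds qs' psi (rcons e x)
  else matrix_holds e psi.

Definition holds (R : realType) (F : signature R) (phi : sentence F) : Prop :=
  prefix_holds (qprefix phi) (matrix_of phi) [::].

Fixpoint closed_prefix (R : realType) (F : signature R) (n : nat)
  (qs : seq (bquant F)) : bool :=
  if qs is Q :: qs' then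
    [&& vars_below n (qlo Q), vars_below n (qhi Q) & closed_prefix n.+1 qs']
  else true.

Definition closed_sentence (R : realType) (F : signature R)
  (phi : sentence F) : bool :=
  closed_prefix 0 (qprefix phi)
  && all (vars_below (size (qprefix phi))) (atoms (matrix_of phi)).

(* The bounds [u], [v] of every quantifier do form an interval [[u, v]], i.e.
   are defined with [u <= v], wherever the preceding variables range. *)
Fixpoint interval_prefix (R : realType) (F : signature R)
  (qs : seq (bquant F)) (e : seq R) : Prop :=
  if qs is Q :: qs' then
    (exists x, in_bounds e Q x) /\
    (forall x, in_bounds e Q x -> interval_prefix qs' (rcons e x))
  else True.

Definition bounded_sentence (R : realType) (F : signature R)
  (phi : sentence F) : Prop :=
  closed_sentence phi /\ interval_prefix (qprefix phi) [::].

(* [n] nonempty blocks, the even-numbered ones existential. *)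
Definition Sigma_sentence (R : realType) (F : signature R) (n : nat)
  (phi : sentence F) : Prop :=
  exists k : nat -> nat,
    map (@qex R F) (qprefix phi) =
    flatten [seq nseq (k i).+1 (~~ odd i) | i <- iota 0 n].

Fixpoint strengthen_matrix (R : realType) (F : signature R) (dlt : rat)
  (psi : matrix_form F) : matrix_form F :=
  match psi with
  | Gt0 t => Gt0 (Add t (Opp (Cst dlt)))
  | Ge0 t => Ge0 (Add t (Opp (Cst dlt)))
  | And p1 p2 => And (strengthen_matrix dlt p1) (strengthen_matrix dlt p2)
  | Or p1 p2 => Or (strengthen_matrix dlt p1) (strengthen_matrix dlt p2)
  end.

Definition strengthen (R : realType) (F : signature R) (dlt : rat)
  (phi : sentence F) : sentence F :=
  Sentence (qprefix phi) (strengthen_matrix dlt (matrix_of phi)).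

(* The substitution [x / u + (v - u) x] needs multiplication, which the
   signature may lack; it is adjoined as the symbol [None]. *)
Definition mul_name (R : realType) (F : signature R) (o : option (fsym F)) :
  word := if o is Some f then true :: fname f else [::].

Lemma mul_name_inj (R : realType) (F : signature R) :
  injective (@mul_name R F).
Proof. by move=> [f|] [g|] //= [] /fname_inj ->. Qed.

Definition with_mul (R : realType) (F : signature R) : signature R :=
  @Signature R (option (fsym F))
    (fun o => if o is Some f then arity f else 2)
    (fun o =>
       match o return pfun R (if o is Some f then arity f else 2) with
       | Some f => @interp R F f
       | None => fun x => Some (tnth x ord0 * tnth x ord_max)
       end)
    (@mul_name R F) (@mul_name_inj R F).

Definition Mul (R : realType) (F : signature R) (s t : term (with_mul F)) :
  term (with_mul F) :=
  @App R (with_mul F) None (fun i : 'I_2 => if i == ord0 then s else t).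

Fixpoint tsubst (R : realType) (F : signature R)
  (sg : seq (term (with_mul F))) (t : term F) : term (with_mul F) :=
  match t with
  | Var i => nth (Var i) sg i
  | Cst q => Cst q
  | Opp s => Opp (tsubst sg s)
  | Add s1 s2 => Add (tsubst sg s1) (tsubst sg s2)
  | Abs s => Abs (tsubst sg s)
  | App f args => @App R (with_mul F) (Some f) (fun i => tsubst sg (args i))
  end.

(* The bounds of a quantifier mention earlier variables, hence are themselves
   subject to the substitution built so far. *)
Fixpoint unit_subst (R : realType) (F : signature R) (qs : seq (bquant F))
  (sg : seq (term (with_mul F))) : seq (term (with_mul F)) :=
  if qs is Q :: qs' then
    let u := tsubst sg (qlo Q) in
    let v := tsubst sg (qhi Q) in
    unit_subst qs' (rcons sg (Add u (Mul (Add v (Opp u)) (Var (size sg)))))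
  else sg.

Fixpoint msubst (R : realType) (F : signature R)
  (sg : seq (term (with_mul F))) (psi : matrix_form F) :
  matrix_form (with_mul F) :=
  match psi with
  | Gt0 t => Gt0 (tsubst sg t)
  | Ge0 t => Ge0 (tsubst sg t)
  | And p1 p2 => And (msubst sg p1) (msubst sg p2)
  | Or p1 p2 => Or (msubst sg p1) (msubst sg p2)
  end.

Definition unit_sentence (R : realType) (F : signature R) (phi : sentence F) :
  sentence (with_mul F) :=
  Sentence [seq BQuant (qex Q) (Cst 0) (Cst 1) | Q <- qprefix phi]
           (msubst (unit_subst (qprefix phi) [::]) (matrix_of phi)).

Fixpoint enc_term (R : realType) (F : signature R) (t : term F) : word :=
  match t with
  | Var i => [:: false; false; false] ++ nseq i true ++ [:: false]
  | Cst q => [:: false; false; true] ++ enc_rat q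
  | Opp s => [:: false; true; false] ++ enc_term s
  | Add s1 s2 => [:: false; true; true] ++ enc_term s1 ++ enc_term s2
  | Abs s => [:: true; false; false] ++ enc_term s
  | App f args =>
      [:: true; false; true] ++ sd (fname f)
      ++ flatten [seq true :: enc_term (args i) | i <- enum 'I_(arity f)]
      ++ [:: false]
  end.

Fixpoint enc_matrix (R : realType) (F : signature R) (psi : matrix_form F) :
  word :=
  match psi with
  | Gt0 t => [:: false; false] ++ sd (enc_term t)
  | Ge0 t => [:: false; true] ++ sd (enc_term t)
  | And p1 p2 => [:: true; false] ++ enc_matrix p1 ++ enc_matrix p2
  | Or p1 p2 => [:: true; true] ++ enc_matrix p1 ++ enc_matrix p2
  end.

Definition enc_bquant (R : realType) (F : signature R) (Q : bquant F) : word :=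
  qex Q :: sd (enc_term (qlo Q)) ++ sd (enc_term (qhi Q)).

Definition enc_sentence (R : realType) (F : signature R) (phi : sentence F) :
  word :=
  flatten [seq true :: enc_bquant Q | Q <- qprefix phi]
  ++ false :: enc_matrix (matrix_of phi).

(* Since a decision problem ranges over infinitely many sentences, complexity
   is defined for families of functions, every member carrying a name that is
   part of the input; a single function is a family with one, empty, name. *)
Record named_fun (R : realType) := NamedFun {
  nf_name : word;
  nf_dim : nat;
  nf_fun : pfun R nf_dim }.

Arguments nf_fun {R} _ _.

Definition fun_family (R : realType) := named_fun R -> Prop.

Definition in_cube (R : realType) (n : nat) (x : n.-tuple R) : Prop :=
  forall l : 'I_n, 0 <= tnth x l <= 1.

Definition point (R : realType) (n : nat) (d : n.-tuple dyadic) : n.-tuple R :=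
  map_tuple (dval R) d.

Definition total_on_cube (R : realType) (A : fun_family R) : Prop :=
  forall f, A f -> forall x, in_cube x -> isSome (nf_fun f x).

Definition is_modulus (R : realType) (A : fun_family R) (m : nat -> nat) : Prop :=
  forall f, A f -> forall (i : nat) (x y : (nf_dim f).-tuple R) (a b : R),
    in_cube x -> in_cube y -> nf_fun f x = Some a -> nf_fun f y = Some b ->
    (forall l, `|tnth x l - tnth y l| < 2 ^- m (size (nf_name f) + i)%N) ->
    `|a - b| < 2 ^- i.

Definition approx := word -> seq dyadic -> nat -> dyadic.

Definition is_approx (R : realType) (A : fun_family R) (theta : approx) : Prop :=
  forall f, A f -> forall (d : (nf_dim f).-tuple dyadic) (i : nat) (a : R),
    in_cube (point R d) -> nf_fun f (point R d) = Some a ->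
    `|dval R (theta (nf_name f) d i) - a| <= 2 ^- i.

Definition is_representation (R : realType) (A : fun_family R) (m : nat -> nat)
  (theta : approx) : Prop :=
  [/\ total_on_cube A, is_modulus A m & is_approx A theta].

Definition enc_query (a : word) (d : seq dyadic) (i : nat) : word :=
  enc_words [:: a; enc_dyadics d; nseq i true].

(* [cost M w y b]: the machine [M] maps [w] to [y] using at most [b] units of
   the resource at hand. *)
Definition class_C01 (cost : machine -> word -> word -> nat -> Prop)
  (R : realType) (A : fun_family R) : Prop :=
  exists (m : {poly nat}) (theta : approx),
    is_representation A (fun i => m.[i]) theta /\
    exists (M : machine) (p : {poly nat}),
      forall f, A f -> forall (d : (nf_dim f).-tuple dyadic) (i : nat),
        in_cube (point R d) ->
        cost M (enc_query (nf_name f) d i)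
          (enc_dyadic (theta (nf_name f) d i))
          p.[(size (nf_name f) + size (enc_dyadics d) + i)%N].

Definition P_C01 (R : realType) (A : fun_family R) : Prop :=
  class_C01 computes_in_time A.

Definition PSPACE_C01 (R : realType) (A : fun_family R) : Prop :=
  class_C01 computes_in_space A.

(* The terms of the sentences [unit_sentence phi], for [phi] in [S]; the name
   of a term consists of [phi] and of its position in [phi]. *)
Definition term_name (R : realType) (F : signature R) (phi : sentence F)
  (j : nat) : word := enc_words [:: enc_sentence phi; nseq j true].

Definition terms_of (R : realType) (F : signature R)
  (S : sentence F -> Prop) : fun_family R :=
  fun f => exists (phi : sentence F) (j : nat),
    [/\ S phi,
        (j < size (atoms (matrix_of (unit_sentence phi))))%N &
        f = @NamedFun R (term_name phi j) (size (qprefix phi))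
              (fun x => eval x (nth (Cst 0)
                                  (atoms (matrix_of (unit_sentence phi))) j))].

Definition poly_time (M : machine) (O : word -> word) : Prop :=
  exists p : {poly nat}, forall w, halting (run M O w p.[size w]).1.

Definition accepts (M : machine) (O : word -> word) (w : word) : Prop :=
  exists t, outputs_within M O w [:: true] t.

(* [n] alternating quantifiers over words of length at most [b], the first one
   existential if and only if [ex]. *)
Fixpoint alternation (ex : bool) (n b : nat) (P : seq word -> Prop)
  (ys : seq word) : Prop :=
  if n is n'.+1 then
    if ex then
      exists2 y : word, (size y <= b)%N & alternation false n' b P (rcons ys y)
    else
      forall y : word, (size y <= b)%N -> alternation true n' b P (rcons ys y)
  else P ys.

Definition SigmaP_language (n : nat) (M : machine) (p : {poly nat})
  (O : word -> word) (x : word) : Prop :=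
  alternation true n p.[size x] (fun ys => accepts M O (enc_words (x :: ys)))
    [::].

Definition oracle_of (theta : approx) (O : word -> word) : Prop :=
  forall a d i, O (enc_query a d i) = enc_dyadic (theta a d i).

(* A problem is given by the languages that solve it.  Oracle access to a
   member of [C] is access to any of its representations, so that no
   information beyond the real functions themselves is available. *)
Definition SigmaP_rel (R : realType) (n : nat) (C : fun_family R -> Prop)
  (solves : (word -> Prop) -> Prop) : Prop :=
  exists A : fun_family R, C A /\
  exists (M : machine) (p : {poly nat}),
    forall (m : nat -> nat) (theta : approx) (O : word -> word),
      is_representation A m theta -> oracle_of theta O ->
      poly_time M O /\ solves (SigmaP_language n M p O).

(* Membership of [enc_sentence phi] in [L] is the answer "True", and
   non-membership the answer "delta-False". *)
Definition delta_decision (R : realType) (F : signature R) (dlt : rat)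
  (S : sentence F -> Prop) (L : word -> Prop) : Prop :=
  forall phi, S phi ->
    (L (enc_sentence phi) -> holds phi) /\
    (~ L (enc_sentence phi) -> ~ holds (strengthen dlt phi)).

(* Main.v *)
(* The verifier is written in a small language of stack programs and compiled to
   a multitape machine: every tape is a stack with its head on the top cell.
   A variable of [unit_sentence phi] is instantiated by a dyadic [0.u], where
   the digit words [u] of one quantifier block are packed into one word [y];
   every word decodes to some point of the unit cube, and the decoded points
   are dense up to the precision allowed by the modulus of continuity, which is
   polynomial since the terms lie in PSPACE.  For every atom the verifier asks
   for an approximation of the term within [2 ^- k.+1] and accepts the atom if
   and only if the answer is at least [2 ^- k], where [2 * 2 ^- k <= dlt]; this
   is decided by the sign and boundedly many bits, hence the length of the
   answer does not matter.  As terms move by less than [2 ^- k.+1] between a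
   real point and a tracking grid point, an accepted atom is positive at the
   real point, and a [dlt]-strengthened atom is accepted at the grid point. *)
Require Import Defs.
From mathcomp Require Import all_boot all_order all_algebra.
From mathcomp Require Import reals zify ring lra.

Set Implicit Arguments.
Unset Strict Implicit.
Unset Printing Implicit Defensive.

Import Order.TTheory GRing.Theory Num.Theory.

(** * Stack programs *)

(** Malformed words can be neither rejected nor accepted outright: rejection would spoil a universal
    block, acceptance an existential one. This is why the decoding has to be total. Moreover
    [poly_time] ranges over all inputs, so the running time is bounded through the sizes of the
    stacks and never through the shape of the decoded data. A decoded digit word may have any
    length. In each implication the reals chosen by one player are rounded to words of length at
    most [L], while the words of the other player denote exact grid points; the comparison therefore
    runs through a word game with separate length bounds for the two players. The verifier never
    evaluates the bounds of a quantifier: the rescaling to the unit cube is part of the terms that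
    the oracle approximates, so the parser may skip them. The number [k] depends on [dlt] alone and
    is built into the machine. *)

Inductive prog : Type :=
| Skip
| Push (i : nat) (b : bool)
| Ask
| Comp (p q : prog)
| Case (i : nat) (pe pf pt : prog)
| Loop (i : nat) (stop : bool) (pf pt : prog).

Definition store := seq word.

Definition get (s : store) (i : nat) : word := nth [::] s i.
Definition put (s : store) (i : nat) (w : word) : store := set_nth [::] s i w.
Arguments get !s !i /.
Arguments put !s !i w /.

Lemma get_put s i w j : get (put s i w) j = if j == i then w else get s j.
Proof. by rewrite /get /put nth_set_nth. Qed.

(** Shared recursion of [sem] and [cost]: [A] is a store for the former and a number of steps for
    the latter. The fuel makes it structural. *)
Fixpoint iterate (A : Type) (halt : store -> A) (f : bool -> store -> store)
  (g : bool -> store -> A -> A) (i : nat) (stop : bool) (fuel : nat)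
  (s : store) : A :=
  if fuel is fuel'.+1 then
    if get s i is b :: w then
      if b || ~~ stop then
        g b (put s i w) (iterate halt f g i stop fuel' (f b (put s i w)))
      else halt s
    else halt s
  else halt s.

Section Programs.

Variable O : word -> word.

(* [Case] pops the symbol it branches on, and so does [Loop], which runs as
   long as its stack is nonempty and, if [stop], has [true] on top. *)
Fixpoint sem (p : prog) (s : store) : store :=
  match p with
  | Skip => s
  | Push i b => put s i (b :: get s i)
  | Ask => put (put s 1 [::]) 2 (O (get s 1))
  | Comp p q => sem q (sem p s)
  | Case i pe pf pt =>
      if get s i is b :: w then
        if b then sem pt (put s i w) else sem pf (put s i w)
      else sem pe s
  | Loop i stop pf pt =>
      iterate id (fun b s => if b then sem pt s else sem pf s)
        (fun _ _ s => s) i stop (size (get s i)) s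
  end.

Fixpoint cost (p : prog) (s : store) : nat :=
  match p with
  | Skip | Ask => 1
  | Push _ _ => 2
  | Comp p q => cost p s + cost q (sem p s)
  | Case i pe pf pt =>
      (if get s i is b :: w then
         if b then cost pt (put s i w) else cost pf (put s i w)
       else cost pe s).+1
  | Loop i stop pf pt =>
      iterate (fun=> 1) (fun b s => if b then sem pt s else sem pf s)
        (fun b s t => (t + if b then cost pt s else cost pf s).+1)
        i stop (size (get s i)) s
  end.

(** Required of loop bodies, so that the height of the loop stack bounds the number of rounds. [Ask]
    fills only the answer stack 2; it empties stack 1. *)
Fixpoint nopush (i : nat) (p : prog) : bool :=
  match p with
  | Skip => true
  | Push j _ => j != i
  | Ask => i != 2
  | Comp p q => nopush i p && nopush i q
  | Case _ pe pf pt => [&& nopush i pe, nopush i pf & nopush i pt]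
  | Loop _ _ pf pt => nopush i pf && nopush i pt
  end.

Fixpoint wf (k : nat) (p : prog) : bool :=
  match p with
  | Skip => true
  | Push j _ => j < k
  | Ask => 2 < k
  | Comp p q => wf k p && wf k q
  | Case i pe pf pt => [&& i < k, wf k pe, wf k pf & wf k pt]
  | Loop i _ pf pt =>
      [&& i < k, wf k pf, wf k pt, nopush i pf & nopush i pt]
  end.

Lemma sem_nopush i p s : nopush i p -> size (get (sem p s) i) <= size (get s i).
Proof.
elim: p s => //=.
- by move=> j b s; rewrite get_put eq_sym => /negbTE->.
- by move=> s /negbTE i2; rewrite !get_put i2; case: ifP.
- by move=> p IHp q IHq s /andP[/IHp hp /IHq hq]; apply: leq_trans (hp s).
- move=> j pe IHe pf IHf pt IHt s /and3P[he hf ht].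
  case E: (get s j) => [|b w]; first exact: IHe.
  have le1 : size (get (put s j w) i) <= size (get s i).
    by rewrite get_put; case: eqP => // ->; rewrite E /=.
  by case: b {E}; apply: leq_trans le1; [apply: IHt | apply: IHf].
- move=> j stop pf IHf pt IHt s /andP[hf ht].
  move: (size (get s j)) => fuel; elim: fuel s => //= k IH s.
  case E: (get s j) => [|b w] //.
  case: ifP => // _; apply: leq_trans (IH _) _.
  have le1 : size (get (put s j w) i) <= size (get s i).
    by rewrite get_put; case: eqP => // ->; rewrite E /=.
  by case: b {E}; apply: leq_trans le1; [apply: IHt | apply: IHf].
Qed.

(** A round pops one cell of stack [i] before the body runs, and the body does not let that stack
    grow; fuel beyond its height is never consumed. *)
Lemma iterate_fuel (A : Type) (halt : store -> A) f
  (g : bool -> store -> A -> A) i stop (fuel : nat) s :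
  (forall b s, size (get (f b s) i) <= size (get s i)) ->
  size (get s i) <= fuel ->
  iterate halt f g i stop fuel s
  = iterate halt f g i stop (size (get s i)) s.
Proof.
move=> hf; have [n] := ubnP (size (get s i)).
elim: n fuel s => // n IH [|fuel] s /=; first by rewrite leqn0 => _ /eqP->.
case E: (get s i) => [|b w] //=.
rewrite !ltnS => le1 le2; rewrite E /=; case: ifP => // _.
have le3 : size (get (f b (put s i w)) i) <= size w.
  by apply: leq_trans (hf _ _) _; rewrite get_put eqxx.
have lt3 := leq_ltn_trans le3 le1.
by rewrite (IH fuel _ lt3 (leq_trans le3 le2)) (IH (size w) _ lt3 le3).
Qed.

Section LoopEquations.

Variables (i : nat) (stop : bool) (pf pt : prog).
Hypotheses (hf : nopush i pf) (ht : nopush i pt).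

Let body_size b s :
  size (get (if b then sem pt s else sem pf s) i) <= size (get s i).
Proof. by case: b; apply: sem_nopush. Qed.

Lemma sem_loop s :
  sem (Loop i stop pf pt) s =
  if get s i is b :: w then
    if b || ~~ stop then
      sem (Loop i stop pf pt) (sem (if b then pt else pf) (put s i w))
    else s
  else s.
Proof.
rewrite /=; case E: (get s i) => [|b w] //=; rewrite E; case: ifP => // _.
rewrite iterate_fuel //; first by case: (b).
by apply: leq_trans (body_size _ _) _; rewrite get_put eqxx.
Qed.

Lemma cost_loop s :
  cost (Loop i stop pf pt) s =
  if get s i is b :: w then
    if b || ~~ stop then
      (cost (Loop i stop pf pt) (sem (if b then pt else pf) (put s i w))
       + cost (if b then pt else pf) (put s i w)).+1
    else 1
  else 1.
Proof.
rewrite /=; case E: (get s i) => [|b w] //=; rewrite E; case: ifP => // _.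
rewrite iterate_fuel //; first by case: (b).
by apply: leq_trans (body_size _ _) _; rewrite get_put eqxx.
Qed.

(** Each round costs one test and at most [c] for the body; the last summand is the test that leaves
    the loop. *)
Lemma cost_loop_const c s :
  (forall s, cost pf s <= c) -> (forall s, cost pt s <= c) ->
  cost (Loop i stop pf pt) s <= (size (get s i)) * c.+1 + 1.
Proof.
move=> cf ct; have [n] := ubnP (size (get s i)); elim: n s => // n IH s.
rewrite cost_loop; case E: (get s i) => [|b w]; first by [].
rewrite ltnS => lt; case: ifP => _; last by rewrite addn1.
set s' := put s i w; set p := if b then pt else pf.
have le3 : size (get (sem p s') i) <= size w.
  have := body_size b s'; rewrite get_put eqxx.
  by rewrite /p; case: (b).
have cp : cost p s' <= c by rewrite /p; case: (b).
have := IH (sem p s') (leq_ltn_trans le3 lt).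
have := leq_mul le3 (leqnn c.+1).
rewrite [size (b :: w)]/=.
move: (cost (Loop _ _ _ _) _) (cost p s') (size w) (size _) cp => a1 a2 a3 a4.
by lia.
Qed.

End LoopEquations.

Lemma sem_skip s : sem Skip s = s. Proof. by []. Qed.
Lemma sem_push i b s : sem (Push i b) s = put s i (b :: get s i).
Proof. by []. Qed.
Lemma sem_ask s : sem Ask s = put (put s 1 [::]) 2 (O (get s 1)).
Proof. by []. Qed.
Lemma sem_comp p q s : sem (Comp p q) s = sem q (sem p s). Proof. by []. Qed.
Lemma sem_case i pe pf pt s :
  sem (Case i pe pf pt) s =
  if get s i is b :: w then
    if b then sem pt (put s i w) else sem pf (put s i w)
  else sem pe s.
Proof. by []. Qed.

Definition semE := (sem_skip, sem_push, sem_ask, sem_comp, sem_case).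

Lemma cost_comp p q s : cost (Comp p q) s = cost p s + cost q (sem p s).
Proof. by []. Qed.

Lemma cost_case i pe pf pt s :
  cost (Case i pe pf pt) s =
  (if get s i is b :: w then
     if b then cost pt (put s i w) else cost pf (put s i w)
   else cost pe s).+1.
Proof. by []. Qed.

Lemma cost_push i b s : cost (Push i b) s = 2. Proof. by []. Qed.
Lemma cost_skip s : cost Skip s = 1. Proof. by []. Qed.
Lemma cost_ask s : cost Ask s = 1. Proof. by []. Qed.

Definition costE := (cost_comp, cost_case, cost_push, cost_skip, cost_ask).

End Programs.

Arguments sem : simpl never.
Arguments cost : simpl never.

(** * Compilation of stack programs to multitape machines *)

(** A machine writes before it moves, so a push takes two steps, and the boolean tells whether the
    head has already moved left. The state [None] of a branch or a loop is its test. *)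
Fixpoint control (p : prog) : finType :=
  match p with
  | Skip | Ask => unit
  | Push _ _ => bool
  | Comp p q => (control p + control q)%type
  | Case _ pe pf pt =>
      option (control pe + (control pf + control pt))%type
  | Loop _ _ pf pt => option (control pf + control pt)%type
  end.

Fixpoint entry (p : prog) : control p :=
  match p return control p with
  | Skip | Ask => tt
  | Push _ _ => false
  | Comp p q => inl (entry p)
  | Case _ _ _ _ | Loop _ _ _ _ => None
  end.

Definition bsym := sym void.
Definition bit (b : bool) : bsym := Some (inl b).

Definition action := option (nat * (bsym * direction)).

Definition popping (i : nat) : action := Some (i, (None, MoveR)).

(* The state [None] is the exit of the program. *)
Fixpoint next (p : prog) (x : control p) (r : nat -> bsym) {struct p} :
  option (control p) * action :=
  match p return control p -> option (control p) * action with
  | Skip | Ask => fun=> (None, None)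
  | Push i b => fun x : bool =>
      if x then (None, Some (i, (bit b, Stay)))
      else (Some true, Some (i, (r i, MoveL)))
  | Comp p q => fun x : control p + control q =>
      match x with
      | inl y => let: (o, a) := next y r in
                 (Some (if o is Some y' then inl y' else inr (entry q)), a)
      | inr y => let: (o, a) := next y r in (omap inr o, a)
      end
  | Case i pe pf pt =>
      fun x : option (control pe + (control pf + control pt)) =>
      match x with
      | None =>
          match r i with
          | Some (inl true) => (Some (Some (inr (inr (entry pt)))), popping i)
          | Some (inl false) => (Some (Some (inr (inl (entry pf)))), popping i)
          | _ => (Some (Some (inl (entry pe))), None)
          end
      | Some (inl y) => let: (o, a) := next y r in (omap (Some \o inl) o, a)
      | Some (inr (inl y)) =>
          let: (o, a) := next y r in (omap (fun y => Some (inr (inl y))) o, a)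
      | Some (inr (inr y)) =>
          let: (o, a) := next y r in (omap (fun y => Some (inr (inr y))) o, a)
      end
  | Loop i stop pf pt =>
      fun x : option (control pf + control pt) =>
      match x with
      | None =>
          match r i with
          | Some (inl true) => (Some (Some (inr (entry pt))), popping i)
          | Some (inl false) =>
              if stop then (None, None)
              else (Some (Some (inl (entry pf))), popping i)
          | _ => (None, None)
          end
      | Some (inl y) => let: (o, a) := next y r in
                        (Some (omap inl o), a)
      | Some (inr y) => let: (o, a) := next y r in
                        (Some (omap inr o), a)
      end
  end x.

Fixpoint asking (p : prog) : control p -> bool :=
  match p return control p -> bool with
  | Skip | Push _ _ => fun=> false
  | Ask => fun=> true
  | Comp p q => fun x : control p + control q =>
      match x with inl y => asking y | inr y => asking y end
  | Case i pe pf pt =>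
      fun x : option (control pe + (control pf + control pt)) =>
      match x with
      | None => false
      | Some (inl y) => asking y
      | Some (inr (inl y)) => asking y
      | Some (inr (inr y)) => asking y
      end
  | Loop i stop pf pt => fun x : option (control pf + control pt) =>
      match x with
      | None => false
      | Some (inl y) => asking y
      | Some (inr y) => asking y
      end
  end.

(** A step writes on every tape, so an untouched tape gets its own symbol back. *)
Definition act_at (a : action) (r : bsym) (j : nat) : bsym * direction :=
  if a is Some (i, m) then if j == i then m else (r, Stay) else (r, Stay).

Section Compile.

Variable K : nat.

(** [resume] sees no tape, so it calls [next] with blanks; the transition out of an [Ask] does not
    depend on the symbols read. *)
Definition compile (p : prog) : machine :=
  @Machine (option (control p)) void K (Some (entry p))
    (fun o => o == None)
    (fun o => if o is Some x then asking x else false)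
    (fun o r =>
       if o is Some x then
         let: (o', a) := next x (fun i => r (inord i)) in
         (o', fun j => act_at a (r j) j)
       else (None, fun j => (r j, Stay)))
    (fun o => if o is Some x then (next x (fun=> None)).1 else None).

(** Writing a blank back on an empty tape creates an explicit blank cell, so tapes are compared cell
    by cell and not as lists. *)
Definition represents (t : tape void) (w : word) : Prop :=
  (forall i, nth None (tleft t) i = None) /\
  (forall i, nth None (tright t) i = nth None [seq bit b | b <- w] i).

Definition tapes := {ffun 'I_K.+3 -> tape void}.

Definition represents_store (ts : tapes) (s : store) : Prop :=
  forall j : 'I_K.+3, represents (ts j) (get s j).

Definition reaches (p : prog) (O : word -> word) (c : config (compile p))
  (t : nat) (c' : config (compile p)) : Prop :=
  exists2 t', t' <= t & iter t' (@step (compile p) O) c = c'.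

Lemma tread_represents t w : represents t w -> tread t = nth None (map bit w) 0.
Proof. by move=> [_ h]; rewrite -h /tread; case: (tright t). Qed.

Lemma represents_nil : represents (tape_of void [::]) [::].
Proof. by split=> i /=; rewrite nth_nil. Qed.

Lemma represents_tape_of w : represents (tape_of void w) w.
Proof. by split=> i //=; rewrite nth_nil. Qed.

Lemma tword_represents t w : represents t w -> tword t = w.
Proof.
move=> [_]; rewrite /tword; elim: w (tright t) => [|b w IH] r h.
  by have := h 0; case: r h => //= a r _ ->.
case: r h => [|a r] h; first by have := h 0.
have /= -> := h 0; congr (_ :: _).
by apply: IH => i; have := h i.+1.
Qed.

Lemma represents_stay t w :
  represents t w -> represents (tmove Stay (twrite (tread t) t)) w.
Proof.
move=> [h1 h2]; split=> //= i; rewrite -h2 /tread.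
by case: (tright t) => //=; case: i => //= i; rewrite nth_nil.
Qed.

Lemma represents_pop t b w :
  represents t (b :: w) -> represents (tmove MoveR (twrite None t)) w.
Proof.
move=> [h1 h2]; split=> /=; first by case.
by move=> i; have := h2 i.+1; case: (tright t) => //=; rewrite !nth_nil.
Qed.

Lemma represents_push t b w : represents t w ->
  represents
    (twrite (bit b) (tmove MoveL (twrite (tread t) t))) (b :: w).
Proof.
move=> ht; have [h1 h2] := represents_stay ht; split=> /= [i|].
  by have := h1 i.+1; rewrite /=; case: (tleft t) => //=; rewrite nth_nil.
by case=> //= i; rewrite h2.
Qed.

Definition act (a : action) (ts : tapes) : tapes :=
  [ffun j => let m := act_at a (tread (ts j)) j in
             tmove m.2 (twrite m.1 (ts j))].

Definition answer (O : word -> word) (ts : tapes) : tapes :=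
  [ffun i => if val i == 1 then tape_of _ [::]
             else if val i == 2 then tape_of _ (O (tword (ts (inord 1))))
             else ts i].

Definition reads (ts : tapes) (i : nat) : bsym :=
  [ffun j => tread (ts j)] (inord i : 'I_K.+3).

Lemma step_compile p O (x : control p) (ts : tapes) :
  @step (compile p) O (Some x, ts) =
  if asking x then ((next x (fun=> None)).1, answer O ts)
  else ((next x (reads ts)).1, act (next x (reads ts)).2 ts).
Proof.
rewrite /step /=; case: (asking x) => //=.
rewrite -/(reads ts); case: (next x (reads ts)) => o a /=; congr (_, _).
by apply/ffunP=> j; rewrite !ffunE.
Qed.

Lemma iter_step_exit p O t ts :
  iter t (@step (compile p) O) (None, ts) = (None, ts).
Proof. by elim: t => //= t ->. Qed.

Lemma reaches_step p O c t c' :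
  @reaches p O (@step (compile p) O c) t c' -> @reaches p O c t.+1 c'.
Proof. by case=> u le_ut <-; exists u.+1 => //; rewrite iterSr. Qed.

Lemma reaches_trans p O c t c' t' c'' :
  @reaches p O c t c' -> @reaches p O c' t' c'' ->
  @reaches p O c (t + t') c''.
Proof.
move=> [u le_ut <-] [v le_vt <-]; exists (v + u); last by rewrite iterD.
by rewrite addnC leq_add.
Qed.

Lemma reaches_refl p O c : @reaches p O c 0 c. Proof. by exists 0. Qed.

Section Embedding.

Variables (p p' : prog) (f : control p -> control p').
Variable (o : option (control p')).
Hypothesis hnext : forall x r,
  next (f x) r = (if (next x r).1 is Some y then Some (f y) else o,
                  (next x r).2).
Hypothesis hask : forall x, asking (f x) = asking x.

(** The map [f] places the states of [p] inside [p'], and [o] is the state that follows the exit of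
    [p]. The tapes evolve identically, so the run is carried over step by step. *)
Lemma reaches_embed O x ts t ts' :
  @reaches p O (Some x, ts) t (None, ts') ->
  @reaches p' O (Some (f x), ts) t (o, ts').
Proof.
case=> u le_ut; elim: u t x ts le_ut => // u IH [//|t] x ts le_ut.
rewrite iterSr => E; apply: reaches_step; move: E.
have -> : @step (compile p') O (Some (f x), ts) =
    (if (@step (compile p) O (Some x, ts)).1 is Some z then Some (f z) else o,
     (@step (compile p) O (Some x, ts)).2).
  by rewrite !step_compile hask; case: asking; rewrite hnext.
case: step => [[z|] ts1] /=; first exact: IH.
(* After its exit [p] idles while [p'] would run on, so the simulation is cut here; this is possible
   because [reaches] only bounds the number of steps. *)
by rewrite iter_step_exit => -[->]; exists 0.
Qed.

End Embedding.

Lemma reads_represents ts s i : i < K.+3 -> represents_store ts s ->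
  reads ts i = if get s i is b :: _ then bit b else None.
Proof.
move=> lt_iK /(_ (inord i)) h.
rewrite /reads ffunE (tread_represents h) inordK //.
by case: (get s i).
Qed.

Lemma act_none ts s : represents_store ts s -> represents_store (act None ts) s.
Proof. by move=> h j; rewrite ffunE; apply: represents_stay. Qed.

Lemma act_pop ts s i b w : represents_store ts s -> get s i = b :: w ->
  represents_store (act (popping i) ts) (put s i w).
Proof.
move=> h E j; rewrite ffunE get_put /act_at /=; case: eqP => [ji|_] /=.
  by apply: (@represents_pop _ b); rewrite -E -ji.
exact: represents_stay.
Qed.

Lemma act_push ts s i b : i < K.+3 -> represents_store ts s ->
  represents_store
    (act (Some (i, (bit b, Stay)))
       (act (Some (i, (reads ts i, MoveL))) ts)) (put s i (b :: get s i)).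
Proof.
move=> lt_iK h j; rewrite /reads !ffunE get_put /act_at; case: eqP => [ji|_] /=.
  have -> : inord i = j by apply: val_inj; rewrite /= inordK.
  by apply: represents_push; rewrite -ji.
exact: (represents_stay (represents_stay (h j))).
Qed.

Lemma answer_represents O ts s : represents_store ts s ->
  represents_store (answer O ts) (put (put s 1 [::]) 2 (O (get s 1))).
Proof.
move=> h j; rewrite ffunE !get_put.
case: eqP => [-> //=|_]; first exact: represents_nil.
case: eqP => [_|_] //=; rewrite (tword_represents (h (inord 1))) inordK //.
exact: represents_tape_of.
Qed.

Lemma compile_correct p O s ts :
  wf K.+3 p -> represents_store ts s ->
  exists2 ts', represents_store ts' (sem O p s) &
    @reaches p O (Some (entry p), ts) (cost O p s) (None, ts').
Proof.
elim: p s ts => [|i b||p IHp q IHq|i pe IHe pf IHf pt IHt|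
                 i stop pf IHf pt IHt] s ts.
- move=> _ h; exists (act None ts); first exact: act_none.
  by apply: reaches_step; rewrite step_compile; apply: reaches_refl.
- move=> lt_iK h; eexists; first exact: (act_push b lt_iK h).
  by do 2![apply: reaches_step; rewrite step_compile /=]; apply: reaches_refl.
- move=> _ h; exists (answer O ts); first exact: answer_represents.
  by apply: reaches_step; rewrite step_compile; apply: reaches_refl.
- move=> /= /andP[wp wq] /(IHp _ _ wp)[ts1 /(IHq _ _ wq)[ts2 h2 r2] r1].
  exists ts2 => //; apply: reaches_trans.
    apply: (@reaches_embed p (Comp p q) inl (Some (inr (entry q)))
      _ _ _ _ _ _ _ r1) => // x r /=.
    by case: (next x r) => [[y|] a].
  apply: (@reaches_embed q (Comp p q) inr None
    _ _ _ _ _ _ _ r2) => // x r /=.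
  by case: (next x r) => [[y|] a].
- move=> /= /and4P[lt_iK we wf' wt] h; rewrite /sem /cost -/sem -/cost.
  have rd := reads_represents lt_iK h.
  case E: (get s i) rd => [|b w] rd.
    have [ts' h' r'] := IHe _ _ we (act_none h).
    exists ts' => //; apply: reaches_step; rewrite step_compile /= rd /=.
    apply: (@reaches_embed pe (Case i pe pf pt) (Some \o inl) None
      _ _ _ _ _ _ _ r') => // x r /=.
    by case: (next x r) => [[y|] a].
  case: b E rd => E rd.
    have [ts' h' r'] := IHt _ _ wt (act_pop h E).
    exists ts' => //; apply: reaches_step; rewrite step_compile /= rd /=.
    apply: (@reaches_embed pt (Case i pe pf pt) (fun y => Some (inr (inr y))) None
      _ _ _ _ _ _ _ r') => // x r /=.
    by case: (next x r) => [[y|] a].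
  have [ts' h' r'] := IHf _ _ wf' (act_pop h E).
  exists ts' => //; apply: reaches_step; rewrite step_compile /= rd /=.
  apply: (@reaches_embed pf (Case i pe pf pt) (fun y => Some (inr (inl y))) None
    _ _ _ _ _ _ _ r') => // x r /=.
  by case: (next x r) => [[y|] a].
- move=> /= /and5P[lt_iK wf' wt nf nt].
  (* Inner induction on the height of the loop stack, which every round lowers. *)
  have [n] := ubnP (size (get s i)); elim: n s ts => // n IH s ts le_n h.
  have rd := reads_represents lt_iK h.
  rewrite sem_loop // cost_loop //.
  case E: (get s i) le_n rd => [|b w] le_n rd.
    exists (act None ts); first exact: act_none.
    by apply: reaches_step; rewrite step_compile /= rd; apply: reaches_refl.
  case: ifP => hb; last first.
    case: b stop hb E le_n rd {IH} => [] [] // _ E le_n rd.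
    exists (act None ts); first exact: act_none.
    by apply: reaches_step; rewrite step_compile /= rd; apply: reaches_refl.
  set p := if b then pt else pf.
  have [ts1 h1 r1] : exists2 ts1, represents_store ts1 (sem O p (put s i w)) &
     @reaches (Loop i stop pf pt) O
       (@step (compile (Loop i stop pf pt)) O (Some None, ts))
       (cost O p (put s i w)) (Some None, ts1).
    rewrite /p step_compile /= rd.
    case: b {p} hb E le_n rd => hb E le_n rd.
      have [ts1 h1 r1] := IHt _ _ wt (act_pop h E); exists ts1 => //=.
      apply: (@reaches_embed pt (Loop i stop pf pt) (fun y => Some (inr y)) (Some None)
        _ _ _ _ _ _ _ r1) => // x r /=.
      by case: (next x r) => [[y|] a].
    have [ts1 h1 r1] := IHf _ _ wf' (act_pop h E); exists ts1 => //=.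
    case: stop {IH} hb => //= _.
    apply: (@reaches_embed pf (Loop i false pf pt) (fun y => Some (inl y)) (Some None)
      _ _ _ _ _ _ _ r1) => // x r /=.
    by case: (next x r) => [[y|] a].
  have lt1 : size (get (sem O p (put s i w)) i) < n.
    apply: leq_ltn_trans (_ : size w < n) => //.
    have -> : size w = size (get (put s i w) i) by rewrite get_put eqxx.
    by apply: sem_nopush; rewrite /p; case: (b).
  have [ts2 h2 r2] := IH _ _ lt1 h1; exists ts2 => //.
  by apply: reaches_step; rewrite addnC; apply: reaches_trans r1 r2.
Qed.

Theorem compile_outputs p O w m (s := w :: nseq m [::]) : wf K.+3 p ->
  outputs_within (compile p) O w (get (sem O p s) 0) (cost O p s).
Proof.
move=> wp; have h0 : represents_store (init (compile p) w).2 s.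
  move=> j; rewrite /= ffunE; case: eqP => [-> //|/eqP j0].
    exact: represents_tape_of.
  have -> : get s j = [::].
    by case: j j0 => [[//|j] hj] _ //=; rewrite /get /= nth_nseq if_same.
  exact: represents_nil.
have [ts' h' [t le_t E]] := compile_correct O wp h0.
have -> : cost O p s = cost O p s - t + t by rewrite subnK.
rewrite /outputs_within /run iterD /init E iter_step_exit; split=> //.
exact: tword_represents (h' ord0).
Qed.

Lemma halted_run M O w t t' :
  halting (run M O w t).1 -> t <= t' -> run M O w t' = run M O w t.
Proof.
move=> h le; rewrite -(subnK le) /run iterD -/(run M O w t).
elim: (t' - t) => //= k ->; case: (run M O w t) h => q ts /= h.
by rewrite h.
Qed.

Lemma outputs_within_inj M O w y y' t t' :
  outputs_within M O w y t -> outputs_within M O w y' t' -> y = y'.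
Proof.
move=> [h <-] [h' <-]; case: (leqP t t') => [le|/ltnW le].
  by rewrite (halted_run h le).
by rewrite (halted_run h' le).
Qed.

End Compile.

(** * The verifier *)

Notation "p ;; q" := (Comp p q) (at level 61, right associativity).

Definition pop i := Case i Skip Skip Skip.

Fixpoint pushes (i : nat) (w : word) : prog :=
  if w is b :: w' then Push i b ;; pushes i w' else Skip.

Arguments pushes : simpl never.

Definition foreach i (f : bool -> prog) := Loop i false (f false) (f true).
Definition pour i j := foreach i (Push j).
Definition clear i := foreach i (fun=> Skip).

(** Consumes one [sd] code: the loop pops the announcing [true], [Case] the announced bit, and [pop]
    the closing [false], which [stop] protects from the loop. *)
Definition scan i (f : bool -> prog) :=
  Loop i true Skip (Case i Skip (f false) (f true)) ;; pop i.

Definition copy i := foreach i (fun b => Push 1 b ;; Push 6 b) ;; pour 6 i.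

(* Stack 0 holds the input [enc_words (x :: ys)], 1 the query and 2 the answer.
   The sentence [x] is parsed on stack 3; 4 and 5 hold, reversed, the parts of
   the query that depend on the sentence and on the point; 6 is scratch and 7
   the part of the current [y] not yet consumed.  Stack 8 collects the
   connectives and atom values of the matrix.  Stack 9 holds the kind of the
   last quantifier, and later the values of subformulas. *)

Definition read_sentence :=
  scan 0 (fun b => Push 6 b ;; pushes 4 [:: true; true; true; b]) ;;
  pour 6 3 ;; pushes 4 [:: true; false].

Definition next_block := clear 7 ;; scan 0 (Push 6) ;; pour 6 7.

(** A new word is fetched exactly when the kind of quantifier changes, so that a block shares one
    word. *)
Definition enter_block (q : bool) :=
  Case 9 Skip (if q then next_block else Skip) (if q then Skip else next_block)
  ;; Push 9 q.

(** The scans of stack 3 skip the two bounds. What is pushed is [enc_dyadic (frac_dyadic u)] with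
    every bit announced once more, as inside a query: the sign and the empty integer part give
    [[:: true; false; true; false]], a digit [b] gives [[:: true; true; true; b]]. *)
Definition read_quantifier :=
  Case 3 Skip (enter_block false) (enter_block true) ;;
  scan 3 (fun=> Skip) ;; scan 3 (fun=> Skip) ;;
  pushes 5 [:: true; false; true; false] ;;
  scan 7 (fun b => pushes 5 [:: true; true; true; b]) ;;
  pushes 5 [:: true; false].

(** The initial [false] on stack 9 simulates a preceding universal quantifier, so that the leading
    existential block fetches its word. The [false] pushed at the end closes the code of the point;
    the precision follows. *)
Definition read_prefix (i : nat) :=
  Push 9 false ;; Loop 3 true Skip read_quantifier ;; pop 3 ;;
  pushes 5 (false :: sd (nseq i true)).

Definition token (b : bool) := pushes 8 [:: b; false].

Fixpoint read_frac (k : nat) : prog :=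
  if k is k'.+1 then
    Case 2 (token false) (token false)
      (Case 2 (token false) (read_frac k') (token true))
  else token false.

(** An integer part carries no leading zero, so a nonempty one already means a value of at least 1;
    only an empty one makes the first [k] fractional digits relevant. *)
Definition read_answer (k : nat) :=
  Case 2 (token false) (Case 2 (token false) (read_frac k) (token true))
    (token false).

(** Copying reverses a stack and the parts are stored reversed, so the last part of the query is
    copied first. In reading order the three bits are the announced end of the unary atom index and
    the end of the term name. *)
Definition query :=
  copy 5 ;; pushes 1 [:: false; false; true] ;; copy 4 ;; Ask.

(** Strict and weak atoms are treated alike: [pop 3] drops the bit that separates them. Four [true]
    increment the unary atom index, which is coded by [sd] twice, in the term name and again in the
    query. *)
Definition read_atom (k : nat) :=
  pop 3 ;; scan 3 (fun=> Skip) ;; query ;; read_answer k ;;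
  pushes 4 (nseq 4 true).

Definition read_connective :=
  Case 3 Skip (pushes 8 [:: false; true]) (pushes 8 [:: true; true]).

Definition read_matrix (k : nat) := Loop 3 false (read_atom k) read_connective.

Definition apply_connective :=
  Case 8 Skip (Case 9 Skip (pop 9 ;; Push 9 false) Skip)
              (Case 9 Skip Skip (pop 9 ;; Push 9 true)).

(** Stack 8 returns the tokens in reverse order, which turns prefix notation into postfix notation;
    a stack of values then suffices. *)
Definition evaluate :=
  Loop 8 false (Case 8 Skip (Push 9 false) (Push 9 true)) apply_connective.

(** The input stack is also the output, hence [clear 0]: words that were not read must not remain
    behind the verdict. *)
Definition decide (k : nat) :=
  read_sentence ;; read_prefix k.+1 ;; read_matrix k ;; evaluate ;;
  clear 0 ;; Case 9 Skip Skip (Push 0 true).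

Lemma wf_pushes i w n : i < n -> wf n (pushes i w).
Proof. by move=> h; elim: w => //= b w IH; rewrite /= h. Qed.

Lemma wf_read_frac k : wf 10 (read_frac k).
Proof. by elim: k => //= k ->. Qed.

Lemma nopush_read_frac i k : 8 != i -> nopush i (read_frac k).
Proof. by move=> h; elim: k => /= [|k ->]; rewrite /= !h. Qed.

Lemma wf_decide k : wf 10 (decide k).
Proof.
by rewrite /= !wf_read_frac !nopush_read_frac ?wf_pushes.
Qed.

Fixpoint loop_free (p : prog) : bool :=
  match p with
  | Skip | Push _ _ | Ask => true
  | Comp p q => loop_free p && loop_free q
  | Case _ pe pf pt => [&& loop_free pe, loop_free pf & loop_free pt]
  | Loop _ _ _ _ => false
  end.

Fixpoint length_of (p : prog) : nat :=
  match p with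
  | Skip | Ask => 1
  | Push _ _ => 2
  | Comp p q => length_of p + length_of q
  | Case _ pe pf pt => (length_of pe + length_of pf + length_of pt).+1
  | Loop _ _ _ _ => 0
  end.

Lemma cost_loop_free O p s : loop_free p -> cost O p s <= length_of p.
Proof.
elim: p s => //= [p IHp q IHq|i pe IHe pf IHf pt IHt] s.
  by move=> /andP[/IHp hp /IHq hq]; rewrite costE leq_add.
move=> /and3P[/IHe he /IHf hf /IHt ht]; rewrite costE ltnS.
case: (get s i) => [|[] w]; rewrite -?addnA.
- by apply: leq_trans (he s) _; rewrite leq_addr.
- by apply: leq_trans (ht _) _; rewrite addnA leq_addl.
- by apply: leq_trans (hf _) _; rewrite addnCA leq_addr.
Qed.

(** A total inverse of [sd], paired with the unread rest: a code that breaks off counts as closed,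
    and a dangling [true] is dropped. *)
Fixpoint chunk (y : word) : word * word :=
  match y with
  | true :: b :: r => let c := chunk r in (b :: c.1, c.2)
  | [:: true] | [::] => ([::], [::])
  | false :: r => ([::], r)
  end.

Lemma chunk_ind (P : word -> Prop) :
  P [::] -> P [:: true] -> (forall r, P (false :: r)) ->
  (forall b r, P r -> P (true :: b :: r)) -> forall y, P y.
Proof.
move=> h0 h1 h2 h3 y; have [n] := ubnP (size y); elim: n y => // n IH.
case=> [|[] [|b r]] //= lt_n; apply: h3; apply: IH; exact: ltnW.
Qed.

Lemma sd_cons b w : sd (b :: w) = [:: true, b & sd w]. Proof. by []. Qed.

Lemma chunk_sd w r : chunk (sd w ++ r) = (w, r).
Proof. by elim: w => //= b w; rewrite -/(sd w) => ->. Qed.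

Lemma size_chunk y : size (chunk y).1 + size (chunk y).2 <= size y.
Proof. by elim/chunk_ind: y => //= b r; lia. Qed.

Definition dbl (w : word) : word := flatten [seq [:: true; b] | b <- w].

Lemma dbl_cat v w : dbl (v ++ w) = dbl v ++ dbl w.
Proof. by rewrite /dbl map_cat flatten_cat. Qed.

Lemma size_dbl w : size (dbl w) = (size w).*2.
Proof. by elim: w => //= b w ->. Qed.

Lemma size_sd w : size (sd w) = (size w).*2.+1.
Proof. by rewrite /sd size_cat size_dbl addn1. Qed.

Arguments dbl : simpl never.
Arguments sd : simpl never.
Arguments enc_dyadic : simpl never.

(** * What the verifier computes *)

Section Semantics.

Variable O : word -> word.

Lemma sem_pushes i w s : i < size s ->
  sem O (pushes i w) s = put s i (catrev w (get s i)).
Proof.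
elim: w s => [|b w IH] s lt_i; rewrite /pushes -/pushes !semE.
  apply: (@eq_from_nth _ [::]) => [|j _].
    by rewrite size_set_nth (maxn_idPr lt_i).
  by rewrite nth_set_nth /=; case: eqP => [->|].
rewrite IH ?size_set_nth; last exact: leq_trans lt_i (leq_maxr _ _).
by rewrite get_put eqxx /put set_set_nth eqxx.
Qed.

Lemma put_put s i v w : put (put s i v) i w = put s i w.
Proof. by rewrite /put set_set_nth eqxx. Qed.

Lemma sem_scan i f s : nopush i (f false) -> nopush i (f true) ->
  sem O (scan i f) s =
  match get s i with
  | true :: b :: r => sem O (scan i f) (sem O (f b) (put s i r))
  | [:: true] => put s i [::]
  | false :: r => put s i r
  | [::] => s
  end.
Proof.
move=> hf ht; rewrite /scan semE sem_loop //=; last by rewrite hf.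
case E: (get s i) => [|[] [|b r]] /=; rewrite semE ?E //.
- rewrite semE get_put eqxx sem_loop /= ?hf // get_put eqxx semE.
  by rewrite get_put eqxx.
- rewrite [sem O (Case _ _ _ _) _]semE get_put eqxx put_put.
  by rewrite [RHS]semE; case: b {E}.
Qed.

Lemma sem_pour63 a0 a1 a2 a3 a4 a5 a6 a7 a8 a9 :
  sem O (pour 6 3)
    [:: a0; a1; a2; a3; a4; a5; a6; a7; a8; a9] =
  [:: a0; a1; a2; catrev a6 a3; a4; a5; [::]; a7; a8; a9].
Proof.
by elim: a6 a3 => [|[] w IH] b; rewrite sem_loop //= semE /= IH.
Qed.

Lemma sem_pour64 a0 a1 a2 a3 a4 a5 a6 a7 a8 a9 :
  sem O (pour 6 4)
    [:: a0; a1; a2; a3; a4; a5; a6; a7; a8; a9] =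
  [:: a0; a1; a2; a3; catrev a6 a4; a5; [::]; a7; a8; a9].
Proof.
by elim: a6 a4 => [|[] w IH] b; rewrite sem_loop //= semE /= IH.
Qed.

Lemma sem_pour65 a0 a1 a2 a3 a4 a5 a6 a7 a8 a9 :
  sem O (pour 6 5)
    [:: a0; a1; a2; a3; a4; a5; a6; a7; a8; a9] =
  [:: a0; a1; a2; a3; a4; catrev a6 a5; [::]; a7; a8; a9].
Proof.
by elim: a6 a5 => [|[] w IH] b; rewrite sem_loop //= semE /= IH.
Qed.

Lemma sem_pour67 a0 a1 a2 a3 a4 a5 a6 a7 a8 a9 :
  sem O (pour 6 7)
    [:: a0; a1; a2; a3; a4; a5; a6; a7; a8; a9] =
  [:: a0; a1; a2; a3; a4; a5; [::]; catrev a6 a7; a8; a9].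
Proof.
by elim: a6 a7 => [|[] w IH] b; rewrite sem_loop //= semE /= IH.
Qed.

Lemma sem_clear0 a0 a1 a2 a3 a4 a5 a6 a7 a8 a9 :
  sem O (clear 0)
    [:: a0; a1; a2; a3; a4; a5; a6; a7; a8; a9] =
  [:: [::]; a1; a2; a3; a4; a5; a6; a7; a8; a9].
Proof.
by elim: a0 => [|[] w IH]; rewrite sem_loop //= semE /= IH.
Qed.

Lemma sem_clear7 a0 a1 a2 a3 a4 a5 a6 a7 a8 a9 :
  sem O (clear 7)
    [:: a0; a1; a2; a3; a4; a5; a6; a7; a8; a9] =
  [:: a0; a1; a2; a3; a4; a5; a6; [::]; a8; a9].
Proof.
by elim: a7 => [|[] w IH]; rewrite sem_loop //= semE /= IH.
Qed.

Lemma sem_copy4 a0 a1 a2 a3 a4 a5 a7 a8 a9 :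
  sem O (copy 4)
    [:: a0; a1; a2; a3; a4; a5; [::]; a7; a8; a9] =
  [:: a0; catrev a4 a1; a2; a3; a4; a5; [::]; a7; a8; a9].
Proof.
rewrite /copy semE.
have -> b6 : sem O (foreach 4 (fun b => Push 1 b ;; Push 6 b))
    [:: a0; a1; a2; a3; a4; a5; b6; a7; a8; a9] =
  [:: a0; catrev a4 a1; a2; a3; [::]; a5; catrev a4 b6; a7; a8; a9].
  by elim: a4 a1 b6 => [|[] w IH] b c; rewrite sem_loop //= !semE /= IH.
by rewrite sem_pour64 !catrevE !cats0 revK.
Qed.

Lemma sem_copy5 a0 a1 a2 a3 a4 a5 a7 a8 a9 :
  sem O (copy 5)
    [:: a0; a1; a2; a3; a4; a5; [::]; a7; a8; a9] =
  [:: a0; catrev a5 a1; a2; a3; a4; a5; [::]; a7; a8; a9].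
Proof.
rewrite /copy semE.
have -> b6 : sem O (foreach 5 (fun b => Push 1 b ;; Push 6 b))
    [:: a0; a1; a2; a3; a4; a5; b6; a7; a8; a9] =
  [:: a0; catrev a5 a1; a2; a3; a4; [::]; catrev a5 b6; a7; a8; a9].
  by elim: a5 a1 b6 => [|[] w IH] b c; rewrite sem_loop //= !semE /= IH.
by rewrite sem_pour65 !catrevE !cats0 revK.
Qed.

Lemma sem_scan_sentence a0 a1 a2 a3 a4 a5 a6 a7 a8 a9 :
  sem O (scan 0 (fun b => Push 6 b ;; pushes 4 [:: true; true; true; b]))
    [:: a0; a1; a2; a3; a4; a5; a6; a7; a8; a9] =
  [:: (chunk a0).2; a1; a2; a3; catrev (dbl (dbl (chunk a0).1)) a4; a5;
      catrev (chunk a0).1 a6; a7; a8; a9].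
Proof.
elim/chunk_ind: a0 a4 a6 => [||r|b r IH] a4 a6.
- by rewrite sem_scan.
- by rewrite sem_scan.
- by rewrite sem_scan.
- rewrite sem_scan //=.
  exact: (IH (b :: true :: true :: true :: a4) (b :: a6)).
Qed.

Lemma sem_scan_word a0 a1 a2 a3 a4 a5 a6 a7 a8 a9 :
  sem O (scan 0 (Push 6))
    [:: a0; a1; a2; a3; a4; a5; a6; a7; a8; a9] =
  [:: (chunk a0).2; a1; a2; a3; a4; a5; catrev (chunk a0).1 a6; a7; a8; a9].
Proof.
elim/chunk_ind: a0 a6 => [||r|b r IH] a6.
- by rewrite sem_scan.
- by rewrite sem_scan.
- by rewrite sem_scan.
- by rewrite sem_scan //=; exact: (IH (b :: a6)).
Qed.

Lemma sem_scan_skip a0 a1 a2 a3 a4 a5 a6 a7 a8 a9 :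
  sem O (scan 3 (fun=> Skip))
    [:: a0; a1; a2; a3; a4; a5; a6; a7; a8; a9] =
  [:: a0; a1; a2; (chunk a3).2; a4; a5; a6; a7; a8; a9].
Proof.
elim/chunk_ind: a3 => [||r|b r IH].
- by rewrite sem_scan.
- by rewrite sem_scan.
- by rewrite sem_scan.
- by rewrite sem_scan //=; exact: IH.
Qed.

Lemma sem_scan_digits a0 a1 a2 a3 a4 a5 a6 a7 a8 a9 :
  sem O (scan 7 (fun b => pushes 5 [:: true; true; true; b]))
    [:: a0; a1; a2; a3; a4; a5; a6; a7; a8; a9] =
  [:: a0; a1; a2; a3; a4; catrev (dbl (dbl (chunk a7).1)) a5; a6;
      (chunk a7).2; a8; a9].
Proof.
elim/chunk_ind: a7 a5 => [||r|b r IH] a5.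
- by rewrite sem_scan.
- by rewrite sem_scan.
- by rewrite sem_scan.
- by rewrite sem_scan //=; exact: (IH (b :: true :: true :: true :: a5)).
Qed.


Lemma sem_read_sentence w :
  sem O read_sentence (w :: nseq 9 [::]) =
  [:: (chunk w).2; [::]; [::]; (chunk w).1;
      catrev (dbl (dbl (chunk w).1) ++ [:: true; false]) [::];
      [::]; [::]; [::]; [::]; [::]].
Proof.
rewrite /read_sentence 2!sem_comp sem_scan_sentence sem_pour63 sem_pushes //=.
by rewrite !catrevE !cats0 revK rev_cat.
Qed.

Lemma sem_next_block a0 a1 a2 a3 a4 a5 a7 a8 a9 :
  sem O next_block [:: a0; a1; a2; a3; a4; a5; [::]; a7; a8; a9] =
  [:: (chunk a0).2; a1; a2; a3; a4; a5; [::]; (chunk a0).1; a8; a9].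
Proof.
rewrite /next_block 2!sem_comp sem_clear7 sem_scan_word sem_pour67.
by rewrite !catrevE !cats0 revK.
Qed.

Lemma sem_enter_block q l a0 a1 a2 a3 a4 a5 a7 a8 (c := chunk a0) :
  sem O (enter_block q) [:: a0; a1; a2; a3; a4; a5; [::]; a7; a8; [:: l]] =
  [:: if l == q then a0 else c.2; a1; a2; a3; a4; a5; [::];
      if l == q then a7 else c.1; a8; [:: q]].
Proof.
rewrite /enter_block sem_comp sem_case /=.
by case: l q => [] [] /=; rewrite ?sem_next_block ?sem_skip sem_push.
Qed.

Definition frac_dyadic (u : word) : dyadic := @Dyadic false [::] u isT.

Lemma dbl_enc_frac_dyadic u :
  dbl (enc_dyadic (frac_dyadic u))
  = [:: true; false; true; false] ++ dbl (dbl u) ++ [:: true; false].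
Proof. by rewrite -(dbl_cat (dbl u) [:: false]). Qed.

Lemma sem_read_quantifier l a0 a1 a2 a3 a4 a5 a7 a8 (c := chunk a0)
    (q := head l a3) (y := if l == q then a7 else c.1) :
  sem O read_quantifier [:: a0; a1; a2; a3; a4; a5; [::]; a7; a8; [:: l]] =
  [:: if l == q then a0 else c.2; a1; a2; (chunk (chunk (behead a3)).2).2; a4;
      catrev (dbl (enc_dyadic (frac_dyadic (chunk y).1))) a5; [::];
      (chunk y).2; a8; [:: q]].
Proof.
rewrite /read_quantifier 5!sem_comp dbl_enc_frac_dyadic.
have -> : sem O (Case 3 Skip (enter_block false) (enter_block true))
    [:: a0; a1; a2; a3; a4; a5; [::]; a7; a8; [:: l]] =
    [:: if l == q then a0 else c.2; a1; a2; behead a3; a4; a5; [::]; y; a8;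
        [:: q]].
  rewrite sem_case /= /y /q; case: (a3) => [|b r] /=; first by rewrite eqxx.
  by case: b; rewrite sem_enter_block.
rewrite !sem_scan_skip.
rewrite [sem O (pushes 5 [:: true; false; true; false]) _]sem_pushes //=.
rewrite sem_scan_digits sem_pushes //=.
by rewrite !catrevE !rev_cat -!catA.
Qed.

(** Here [l] is the kind of the preceding quantifier, [y] the unread part of the current word and
    [ys] the words not yet fetched; a missing word counts as empty. *)
Fixpoint decode (l : bool) (y : word) (ys : seq word) (qs : seq bool) :
  seq word :=
  if qs is q :: qs' then
    let y' := if l == q then y else head [::] ys in
    (chunk y').1
    :: decode q (chunk y').2 (if l == q then ys else behead ys) qs'
  else [::].

Lemma chunk_enc_words ys :
  chunk (enc_words ys) = (head [::] ys, enc_words (behead ys)).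
Proof. by case: ys => // y ys; rewrite /enc_words /= chunk_sd. Qed.

(** The bounds are only skipped, so they enter as arbitrary words. *)
Definition qcode (t : bool * word * word) : word :=
  true :: t.1.1 :: sd t.1.2 ++ sd t.2.

Lemma sem_read_quantifiers ts m l y ys a1 a2 a4 a5 a8 :
  exists b0 b7 b9,
  sem O (Loop 3 true Skip read_quantifier)
    [:: enc_words ys; a1; a2; flatten (map qcode ts) ++ false :: m; a4; a5;
        [::]; y; a8; [:: l]] =
  [:: b0; a1; a2; false :: m; a4;
      catrev (dbl (enc_dyadics (map frac_dyadic
        (decode l y ys [seq t.1.1 | t <- ts])))) a5;
      [::]; b7; a8; b9].
Proof.
elim: ts l y ys a5 => [|[[q u] v] ts IH] l y ys a5.
  by do 3!eexists; rewrite sem_loop //=.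
set ys' := if l == q then ys else behead ys.
set y' := if l == q then y else head [::] ys.
set r := flatten (map qcode ts) ++ false :: m.
have [b0 [b7 [b9 H]]] := IH q (chunk y').2 ys'
  (catrev (dbl (enc_dyadic (frac_dyadic (chunk y').1))) a5).
exists b0, b7, b9; rewrite -[map qcode _]/(qcode (q, u, v) :: map qcode ts).
have -> : flatten (qcode (q, u, v) :: map qcode ts) ++ false :: m
  = [:: true, q & sd u ++ sd v ++ r] by rewrite /= -!catA.
have E : sem O read_quantifier [:: enc_words ys; a1; a2;
     q :: sd u ++ sd v ++ r; a4; a5; [::]; y; a8; [:: l]] =
   [:: enc_words ys'; a1; a2; r; a4;
      catrev (dbl (enc_dyadic (frac_dyadic (chunk y').1))) a5;
      [::]; (chunk y').2; a8; [:: q]].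
  rewrite sem_read_quantifier [head _ _]/= [behead _]/= !chunk_sd.
  by rewrite chunk_enc_words /ys' /y'; case: (l == q).
transitivity (sem O (Loop 3 true Skip read_quantifier)
  (sem O read_quantifier [:: enc_words ys; a1; a2;
     q :: sd u ++ sd v ++ r; a4; a5; [::]; y; a8; [:: l]])).
  by rewrite sem_loop.
rewrite E H.
have -> : decode l y ys [seq t.1.1 | t <- (q, u, v) :: ts] =
  (chunk y').1 :: decode q (chunk y').2 ys' [seq t.1.1 | t <- ts] by [].
have -> us w : enc_dyadics (map frac_dyadic (w :: us))
  = enc_dyadic (frac_dyadic w) ++ enc_dyadics (map frac_dyadic us) by [].
by rewrite dbl_cat !catrevE rev_cat -catA.
Qed.

Lemma sem_read_prefix i ts m ys a1 a2 a4 a8 :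
  exists b0 b7 b9,
  sem O (read_prefix i)
    [:: enc_words ys; a1; a2; flatten (map qcode ts) ++ false :: m; a4; [::];
        [::]; [::]; a8; [::]] =
  [:: b0; a1; a2; m; a4;
      rev (sd (enc_dyadics (map frac_dyadic
        (decode false [::] ys [seq t.1.1 | t <- ts]))) ++ sd (nseq i true));
      [::]; b7; a8; b9].
Proof.
rewrite /read_prefix 3!sem_comp sem_push /=.
have [b0 [b7 [b9 ->]]] :=
  sem_read_quantifiers ts m false [::] ys a1 a2 a4 [::] a8.
exists b0, b7, b9; rewrite sem_case /= sem_skip sem_pushes //=.
do 5!congr cons; rewrite {2}/sd -/(dbl _) -catA rev_cat /=.
by rewrite !catrevE cats0 rev_cons -cats1 -catA.
Qed.

Fixpoint has_true (k : nat) (w : word) : bool :=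
  if k is k'.+1 then
    if w is true :: b :: r then b || has_true k' r else false
  else false.

Definition accepted (k : nat) (w : word) : bool :=
  if w is false :: b :: r then b || has_true k r else false.

Lemma sem_read_answer k a0 a1 a2 a3 a4 a5 a6 a7 a8 a9 : exists b2,
  sem O (read_answer k) [:: a0; a1; a2; a3; a4; a5; a6; a7; a8; a9] =
  [:: a0; a1; b2; a3; a4; a5; a6; a7; false :: accepted k a2 :: a8; a9].
Proof.
have E b c2 : sem O (token b) [:: a0; a1; c2; a3; a4; a5; a6; a7; a8; a9] =
  [:: a0; a1; c2; a3; a4; a5; a6; a7; false :: b :: a8; a9] by [].
have F c2 : exists b2,
  sem O (read_frac k) [:: a0; a1; c2; a3; a4; a5; a6; a7; a8; a9] =
  [:: a0; a1; b2; a3; a4; a5; a6; a7; false :: has_true k c2 :: a8; a9].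
  elim: k c2 => [|k IH] c2 /=; first by exists c2.
  rewrite sem_case /=; case: c2 => [|[] w] /=; do ?[by eexists; rewrite E].
  rewrite sem_case /=; case: w => [|[] w] /=; do ?[by eexists; rewrite E].
  exact: IH.
rewrite /read_answer sem_case /=.
case: a2 => [|[] w] /=; do ?[by eexists; rewrite E].
rewrite sem_case /=; case: w => [|[] w] /=; do ?[by eexists; rewrite E].
exact: F.
Qed.

Definition query_word (p s : word) : word :=
  catrev p [:: true, false, false & rev s].

Lemma sem_query a0 a2 a3 a4 a5 a7 a8 a9 :
  sem O query [:: a0; [::]; a2; a3; a4; a5; [::]; a7; a8; a9] =
  [:: a0; [::]; O (query_word a4 a5); a3; a4; a5; [::]; a7; a8; a9].
Proof. by rewrite /query 3!sem_comp sem_copy5 sem_pushes //= sem_copy4. Qed.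

Lemma sem_read_atom k a0 a2 a3 a4 a5 a7 a8 a9 : exists b2,
  sem O (read_atom k) [:: a0; [::]; a2; a3; a4; a5; [::]; a7; a8; a9] =
  [:: a0; [::]; b2; (chunk (behead a3)).2; nseq 4 true ++ a4; a5; [::]; a7;
      false :: accepted k (O (query_word a4 a5)) :: a8; a9].
Proof.
rewrite /read_atom 4!sem_comp.
have -> : sem O (pop 3) [:: a0; [::]; a2; a3; a4; a5; [::]; a7; a8; a9] =
   [:: a0; [::]; a2; behead a3; a4; a5; [::]; a7; a8; a9].
  by rewrite sem_case /=; case: (a3) => [|[] r].
rewrite sem_scan_skip sem_query.
have [b2 ->] := sem_read_answer k a0 [::] (O (query_word a4 a5))
  (chunk (behead a3)).2 a4 a5 [::] a7 a8 a9.
by exists b2; rewrite sem_pushes.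
Qed.

Section Matrix.

Variables (R : realType) (F : signature R).
Implicit Type psi : matrix_form F.

(** The offset [j] is the position of the first atom of [psi] in the whole matrix. *)
Fixpoint tokens (ans : nat -> bool) (j : nat) psi : word :=
  match psi with
  | Gt0 _ | Ge0 _ => [:: ans j; false]
  | And p q => [:: false; true] ++ tokens ans j p
               ++ tokens ans (j + size (atoms p)) q
  | Or p q => [:: true; true] ++ tokens ans j p
               ++ tokens ans (j + size (atoms p)) q
  end.

Fixpoint mvalue (ans : nat -> bool) (j : nat) psi : bool :=
  match psi with
  | Gt0 _ | Ge0 _ => ans j
  | And p q => mvalue ans j p && mvalue ans (j + size (atoms p)) q
  | Or p q => mvalue ans j p || mvalue ans (j + size (atoms p)) q
  end.

(** The loop does not stop between subformulas, so the effect of reading [psi] is stated as an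
    equality of two runs of the same loop, with an arbitrary rest [r]; in this form the induction
    hypotheses compose. *)
Lemma sem_read_matrix k psi j r a0 a2 p s a7 a8 a9
    (ans := fun j => accepted k (O (query_word (nseq (4 * j) true ++ p) s))) :
  exists b2,
  sem O (read_matrix k)
    [:: a0; [::]; a2; enc_matrix psi ++ r; nseq (4 * j) true ++ p; s; [::]; a7;
        a8; a9] =
  sem O (read_matrix k)
    [:: a0; [::]; b2; r; nseq (4 * (j + size (atoms psi))) true ++ p; s;
        [::]; a7; catrev (tokens ans j psi) a8; a9].
Proof.
have np : nopush 3 (read_atom k) by rewrite /= nopush_read_frac.
have C c2 c3 b c4 c8 : sem O (read_matrix k)
    [:: a0; [::]; c2; [:: true, b & c3]; c4; s; [::]; a7; c8; a9] =
  sem O (read_matrix k)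
    [:: a0; [::]; c2; c3; c4; s; [::]; a7; [:: true, b & c8]; a9].
  by rewrite {1}/read_matrix sem_loop //=; case: b.
have E i b t c2 c3 c8 : exists b2,
  sem O (read_matrix k)
    [:: a0; [::]; c2; [:: false, b & sd t ++ c3]; nseq (4 * i) true ++ p; s;
        [::]; a7; c8; a9] =
  sem O (read_matrix k)
    [:: a0; [::]; b2; c3; nseq (4 * (i + 1)) true ++ p; s;
        [::]; a7; [:: false, ans i & c8]; a9].
  have [b2 H] := sem_read_atom k a0 c2 (b :: sd t ++ c3)
    (nseq (4 * i) true ++ p) s a7 c8 a9.
  exists b2; transitivity (sem O (read_matrix k) (sem O (read_atom k)
    [:: a0; [::]; c2; b :: sd t ++ c3; nseq (4 * i) true ++ p; s; [::]; a7; c8;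
        a9])); first by rewrite {1}/read_matrix sem_loop.
  rewrite H.
  by rewrite [behead _]/= chunk_sd addn1 mulnS nseqD -catA.
elim: psi j r a2 a8 => [t|t|p1 IH1 p2 IH2|p1 IH1 p2 IH2] j r a2 a8 /=.
- exact: E.
- exact: E.
- have [b2 H1] := IH1 j (enc_matrix p2 ++ r) a2 [:: true, false & a8].
  have [b2' H2] := IH2 (j + size (atoms p1)) r b2
    (catrev (tokens ans j p1) [:: true, false & a8]).
  exists b2'; rewrite C -catA H1 H2 size_cat addnA.
  by rewrite !catrevE rev_cat -catA.
- have [b2 H1] := IH1 j (enc_matrix p2 ++ r) a2 [:: true, true & a8].
  have [b2' H2] := IH2 (j + size (atoms p1)) r b2
    (catrev (tokens ans j p1) [:: true, true & a8]).
  exists b2'; rewrite C -catA H1 H2 size_cat addnA.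
  by rewrite !catrevE rev_cat -catA.
Qed.

Lemma sem_evaluate ans j psi a0 a1 a2 a3 a4 a5 a6 a7 a8 a9 :
  sem O evaluate [:: a0; a1; a2; a3; a4; a5; a6; a7;
                     catrev (tokens ans j psi) a8; a9] =
  sem O evaluate [:: a0; a1; a2; a3; a4; a5; a6; a7; a8;
                     mvalue ans j psi :: a9].
Proof.
elim: psi j a8 a9 => [t|t|p1 IH1 p2 IH2|p1 IH1 p2 IH2] j a8 a9 /=.
- by rewrite {1}/evaluate sem_loop //=; case: (ans j).
- by rewrite {1}/evaluate sem_loop //=; case: (ans j).
- have -> : catrev (tokens ans j p1 ++ tokens ans (j + size (atoms p1)) p2)
    [:: true, false & a8] = catrev (tokens ans (j + size (atoms p1)) p2)
    (catrev (tokens ans j p1) [:: true, false & a8]).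
    by rewrite !catrevE rev_cat -catA.
  rewrite IH2 IH1 {1}/evaluate sem_loop //=.
  by case: (mvalue ans j p1); case: (mvalue ans _ p2).
- have -> : catrev (tokens ans j p1 ++ tokens ans (j + size (atoms p1)) p2)
    [:: true, true & a8] = catrev (tokens ans (j + size (atoms p1)) p2)
    (catrev (tokens ans j p1) [:: true, true & a8]).
    by rewrite !catrevE rev_cat -catA.
  rewrite IH2 IH1 {1}/evaluate sem_loop //=.
  by case: (mvalue ans j p1); case: (mvalue ans _ p2).
Qed.

(** The sentence and the atom index are coded by [sd] inside the term name, and the name again
    inside the query, so each of their bits occupies four cells. *)
Lemma query_wordE x j w i :
  query_word
    (nseq (4 * j) true ++ catrev (dbl (dbl x) ++ [:: true; false]) [::])
    (rev (sd w ++ sd (nseq i true)))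
  = enc_words [:: enc_words [:: x; nseq j true]; w; nseq i true].
Proof.
have E : dbl (dbl (nseq j true)) = nseq (4 * j) true.
  by elim: j => // j IH; rewrite mulnS nseqD -IH.
have -> : enc_words [:: enc_words [:: x; nseq j true]; w; nseq i true]
  = sd (sd x ++ sd (nseq j true)) ++ sd w ++ sd (nseq i true).
  by rewrite /enc_words /= !cats0.
rewrite /query_word catrevE revK catrevE cats0 rev_cat revK.
rewrite rev_nseq.
have sdE v : sd v = dbl v ++ [:: false] by [].
by rewrite [sd (_ ++ _)]sdE !sdE !dbl_cat -!catA E.
Qed.

Lemma eq_mvalue ans ans' j psi :
  ans =1 ans' -> mvalue ans j psi = mvalue ans' j psi.
Proof. by move=> E; elim: psi j => //= p IHp q IHq j; rewrite IHp IHq. Qed.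

Lemma sem_decide k psi ts ys
    (x := flatten (map qcode ts) ++ false :: enc_matrix psi)
    (ds := map frac_dyadic (decode false [::] ys [seq t.1.1 | t <- ts]))
    (ans := fun j => accepted k
       (O (enc_words [:: enc_words [:: x; nseq j true]; enc_dyadics ds;
                         nseq k.+1 true]))) :
  get (sem O (decide k) (enc_words (x :: ys) :: nseq 9 [::])) 0 =
  nseq (mvalue ans 0 psi) true.
Proof.
rewrite /decide 5!sem_comp sem_read_sentence.
rewrite -[enc_words _]/(sd x ++ enc_words ys) chunk_sd.
have [b0 [b7 [b9 ->]]] := sem_read_prefix k.+1 ts (enc_matrix psi) ys [::] [::]
  (catrev (dbl (dbl x) ++ [:: true; false]) [::]) [::].
rewrite -/ds -[enc_matrix psi]cats0.
have [b2] := sem_read_matrix k psi 0 [::] b0 [::]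
  (catrev (dbl (dbl x) ++ [:: true; false]) [::])
  (rev (sd (enc_dyadics ds) ++ sd (nseq k.+1 true))) b7 [::] b9.
rewrite muln0 cat0s => ->; set ans' := (X in tokens X _ _).
have E : ans' =1 ans by move=> j; rewrite /ans' query_wordE.
move: ans' E => ans' E.
rewrite {1}/read_matrix sem_loop //=; last by rewrite nopush_read_frac.
rewrite sem_evaluate {1}/evaluate sem_loop //= sem_clear0 sem_case /=.
rewrite (eq_mvalue _ _ E).
by case: mvalue.
Qed.

End Matrix.

End Semantics.

(** * Running time *)

Lemma length_pushes i w : length_of (pushes i w) = (size w).*2.+1.
Proof. by elim: w => //= b w IH; rewrite /= IH. Qed.

Section Cost.

Variable O : word -> word.

Lemma cost_foreach i f s :
  nopush i (f false) -> nopush i (f true) ->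
  loop_free (f false) -> loop_free (f true) ->
  cost O (foreach i f) s <=
  size (get s i) * (length_of (f false) + length_of (f true)).+1 + 1.
Proof.
move=> nf nt lf lt; apply: cost_loop_const => // s'.
  by apply: leq_trans (cost_loop_free _ _ lf) _; rewrite leq_addr.
by apply: leq_trans (cost_loop_free _ _ lt) _; rewrite leq_addl.
Qed.

Lemma cost_scan i f s :
  nopush i (f false) -> nopush i (f true) ->
  loop_free (f false) -> loop_free (f true) ->
  cost O (scan i f) s <=
  size (get s i) * (length_of (f false) + length_of (f true) + 3) + 5.
Proof.
move=> nf nt lf lt; rewrite /scan cost_comp.
set p := Case i Skip (f false) (f true).
have lp : loop_free p by rewrite /= lf lt.
have -> : length_of (f false) + length_of (f true) + 3 = (length_of p).+1.
  by rewrite /=; lia.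
rewrite -[5]/(1 + 4) addnA leq_add //; last exact: (@cost_loop_free O (pop i)).
apply: cost_loop_const => //=.
- by rewrite nf nt.
- by move=> s'; apply: cost_loop_free.
Qed.

Lemma cost_read_sentence w :
  cost O read_sentence (w :: nseq 9 [::]) <= 30 * size w + 20.
Proof.
rewrite /read_sentence 2!cost_comp sem_scan_sentence sem_pour63.
have := @cost_scan 0 (fun b => Push 6 b ;; pushes 4 [:: true; true; true; b])
  (w :: nseq 9 [::]) isT isT isT isT.
have := @cost_foreach 6 (Push 3) [:: (chunk w).2; [::]; [::]; [::];
  catrev (dbl (dbl (chunk w).1)) [::]; [::]; catrev (chunk w).1 [::];
  [::]; [::]; [::]] isT isT isT isT.
rewrite /= ?length_pushes catrevE cats0 size_rev -/(pour 6 3) /=.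
have := size_chunk w.
set p := pushes 4 [:: true; false].
set c := cost O p _.
have : c <= 5 by apply: (@cost_loop_free O p).
move: c (cost O _ _) (cost O _ _) => c1 c2 c3.
by move: (size (chunk w).1) (size (chunk w).2) => n1 n2; lia.
Qed.

Lemma cost_next_block a0 a1 a2 a3 a4 a5 a7 a8 a9 :
  cost O next_block [:: a0; a1; a2; a3; a4; a5; [::]; a7; a8; a9]
  <= 12 * size a0 + 3 * size a7 + 7.
Proof.
rewrite /next_block 2!cost_comp sem_clear7 sem_scan_word catrevE cats0.
have := @cost_foreach 7 (fun=> Skip)
  [:: a0; a1; a2; a3; a4; a5; [::]; a7; a8; a9] isT isT isT isT.
have := @cost_scan 0 (Push 6)
  [:: a0; a1; a2; a3; a4; a5; [::]; [::]; a8; a9] isT isT isT isT.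
have := @cost_foreach 6 (Push 7)
  [:: (chunk a0).2; a1; a2; a3; a4; a5; rev (chunk a0).1; [::]; a8; a9]
  isT isT isT isT.
rewrite -/(clear 7) -/(pour 6 7) /= size_rev; have := size_chunk a0.
move: (cost O _ _) (cost O _ _) (cost O _ _) => c1 c2 c3.
by move: (size (chunk a0).1) (size (chunk a0).2) => n1 n2; lia.
Qed.

Lemma cost_enter_block q l a0 a1 a2 a3 a4 a5 a7 a8 :
  cost O (enter_block q) [:: a0; a1; a2; a3; a4; a5; [::]; a7; a8; [:: l]]
  <= 12 * size a0 + 3 * size a7 + 10.
Proof.
rewrite /enter_block cost_comp cost_push cost_case /=.
have := cost_next_block a0 a1 a2 a3 a4 a5 a7 a8 [::].
by case: l q => [] [] /=; rewrite ?cost_skip; lia.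
Qed.

Lemma cost_read_quantifier l a0 a1 a2 a3 a4 a5 a7 a8 m :
  size a0 <= m -> size a7 <= m ->
  cost O read_quantifier [:: a0; a1; a2; a3; a4; a5; [::]; a7; a8; [:: l]]
  <= 40 * m + 10 * size a3 + 60.
Proof.
move=> le0 le7; rewrite /read_quantifier 5!cost_comp.
pose q := head l a3; pose c := chunk a0.
pose y := if l == q then a7 else c.1.
have -> : sem O (Case 3 Skip (enter_block false) (enter_block true))
    [:: a0; a1; a2; a3; a4; a5; [::]; a7; a8; [:: l]] =
    [:: if l == q then a0 else c.2; a1; a2; behead a3; a4; a5; [::]; y; a8;
        [:: q]].
  rewrite sem_case /= /y /q; case: (a3) => [|b r] /=; first by rewrite eqxx.
  by case: b; rewrite sem_enter_block.
rewrite !sem_scan_skip.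
set a0' := if l == q then a0 else c.2.
have ley : size y <= m.
  by rewrite /y; case: ifP => _ //; have := size_chunk a0; rewrite -/c; lia.
have H1 : cost O (Case 3 Skip (enter_block false) (enter_block true))
    [:: a0; a1; a2; a3; a4; a5; [::]; a7; a8; [:: l]] <= 15 * m + 11.
  rewrite cost_case /=; case: (a3) => [|b r] /=.
    by rewrite cost_skip; lia.
  have H b' := cost_enter_block b' l a0 a1 a2 r a4 a5 a7 a8.
  by case: b; [have := H true | have := H false]; lia.
have H2 := @cost_scan 3 (fun=> Skip)
  [:: a0'; a1; a2; behead a3; a4; a5; [::]; y; a8; [:: q]] isT isT isT isT.
have H3 := @cost_scan 3 (fun=> Skip)
  [:: a0'; a1; a2; (chunk (behead a3)).2; a4; a5; [::]; y; a8; [:: q]]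
  isT isT isT isT.
rewrite /= in H2 H3.
set p1 := pushes 5 [:: true; false; true; false].
have -> : sem O p1 [:: a0'; a1; a2; (chunk (chunk (behead a3)).2).2; a4; a5;
  [::]; y; a8; [:: q]] = [:: a0'; a1; a2; (chunk (chunk (behead a3)).2).2; a4;
  [:: false, true, false, true & a5]; [::]; y; a8; [:: q]] by [].
have H4 s : cost O p1 s <= 9 by apply: (@cost_loop_free O p1).
have H5 s : cost O (pushes 5 [:: true; false]) s <= 5.
  by apply: (@cost_loop_free O (pushes 5 [:: true; false])).
have H6 := @cost_scan 7 (fun b => pushes 5 [:: true; true; true; b])
  [:: a0'; a1; a2; (chunk (chunk (behead a3)).2).2; a4;
  [:: false, true, false, true & a5]; [::]; y; a8; [:: q]] isT isT isT isT.
rewrite /= ?length_pushes /= in H6.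
have := H4 [:: a0'; a1; a2; (chunk (chunk (behead a3)).2).2; a4; a5; [::]; y;
  a8; [:: q]].
have := H5 (sem O (scan 7 (fun b => pushes 5 [:: true; true; true; b]))
  [:: a0'; a1; a2; (chunk (chunk (behead a3)).2).2; a4;
  [:: false, true, false, true & a5]; [::]; y; a8; [:: q]]).
move: H1 H2 H3 H6; do 6!move: (cost O _ _) => ?.
have : size (behead a3) <= size a3 by rewrite size_behead leq_pred.
have := size_chunk (behead a3).
by move: (size (chunk _).1) (size (chunk _).2) => ? ?; nia.
Qed.

(** Whatever the input, a round consumes at least one cell of stack 3, and splitting off chunks
    keeps stacks 0 and 7 below [m]. A round adds to stack 5 four cells per digit and six for the
    sign, the integer part and the end of the dyadic. *)
Lemma cost_read_quantifiers l a0 a1 a2 a3 a4 a5 a7 a8 m n :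
  size a0 <= m -> size a7 <= m -> size a3 <= n ->
  (exists b0 b3 b5 b7 l',
  [/\ sem O (Loop 3 true Skip read_quantifier)
        [:: a0; a1; a2; a3; a4; a5; [::]; a7; a8; [:: l]] =
      [:: b0; a1; a2; b3; a4; b5; [::]; b7; a8; [:: l']],
      size b0 <= m, size b3 <= n &
      size b5 <= size a5 + size a3 * (4 * m + 6)]) /\
  cost O (Loop 3 true Skip read_quantifier)
    [:: a0; a1; a2; a3; a4; a5; [::]; a7; a8; [:: l]]
  <= size a3 * (40 * m + 10 * n + 61) + 1.
Proof.
have [k] := ubnP (size a3).
elim: k l a0 a3 a5 a7 => // k IH l a0 a3 a5 a7 lt_k le0 le7 le3.
rewrite sem_loop // cost_loop //; case: a3 lt_k le3 => [|b r] lt_k le3.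
  by split=> //=; exists a0, [::], a5, a7, l; split=> //=; lia.
case: b lt_k le3 => lt_k le3; last first.
  split; last by rewrite /=; lia.
  by exists a0, (false :: r), a5, a7, l; split=> //=; lia.
rewrite /=.
have H := @cost_read_quantifier l a0 a1 a2 r a4 a5 a7 a8 m le0 le7.
move: H; rewrite sem_read_quantifier.
set q := head l r; set a0' := if l == q then a0 else _.
set y := if l == q then a7 else _; set r' := (chunk _).2.
set a5' := catrev _ a5; move: (cost O _ _) => c Hc.
have le0' : size a0' <= m.
  by rewrite /a0'; case: ifP => _ //; have := size_chunk a0; lia.
have ley : size y <= m.
  by rewrite /y; case: ifP => _ //; have := size_chunk a0; lia.
have le7' : size (chunk y).2 <= m by have := size_chunk y; lia.
have ler : size r' <= size r.
  do 2!apply: leq_trans (leq_trans (leq_addl _ _) (size_chunk _)) _.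
  by rewrite size_behead leq_pred.
have le5' : size a5' <= size a5 + (4 * m + 6).
  rewrite /a5' catrevE size_cat size_rev dbl_enc_frac_dyadic !size_cat /=.
  by rewrite !size_dbl; have := size_chunk y; lia.
have ltr : size r' < k by apply: leq_ltn_trans ler _; move: lt_k => /=; lia.
have len : size r' <= n by apply: leq_trans ler _; move: le3 => /=; lia.
have [[b0 [b3 [b5 [b7 [l' [-> h0 h3 h5]]]]]] hc] :=
  IH q a0' r' a5' (chunk y).2 ltr le0' le7' len.
split; first by exists b0, b3, b5, b7, l'; split=> //=; nia.
by move: hc le3 => /=; move: (cost O _ _) => ?; nia.
Qed.

Lemma cost_query a0 a2 a3 a4 a5 a7 a8 a9 :
  cost O query [:: a0; [::]; a2; a3; a4; a5; [::]; a7; a8; a9]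
  <= 14 * (size a4 + size a5) + 12.
Proof.
rewrite /query 3!cost_comp sem_copy5.
set p := pushes 1 [:: false; false; true].
set v := catrev a5 [::].
have -> : sem O p [:: a0; v; a2; a3; a4; a5; [::]; a7; a8; a9] =
  [:: a0; [:: true, false, false & v]; a2; a3; a4; a5; [::]; a7; a8; a9] by [].
have H1 : cost O p [:: a0; v; a2; a3; a4; a5; [::]; a7; a8; a9] <= 7.
  exact: (@cost_loop_free O p).
have copyE i s : 1 < i -> i != 6 -> size (get (sem O (foreach i
    (fun b => Push 1 b ;; Push 6 b)) s) 6) <= size (get s i) ->
  cost O (copy i) s <= 14 * size (get s i) + 2.
  move=> i1 i6; rewrite /copy cost_comp.
  set s' := sem O _ _; have := @cost_foreach 6 (Push i) s' i6 i6 isT isT.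
  have n1 b : nopush i (Push 1 b ;; Push 6 b).
    by rewrite /= (ltn_eqF i1) eq_sym i6.
  have := @cost_foreach i (fun b => Push 1 b ;; Push 6 b) s
    (n1 _) (n1 _) isT isT.
  by rewrite -/(pour 6 i) /=; do 2!move: (cost O _ _) => ?; lia.
have H2 : cost O (copy 5) [:: a0; [::]; a2; a3; a4; a5; [::]; a7; a8; a9]
   <= 14 * size a5 + 2.
  apply: (copyE 5) => //.
  have F b1 b6 : sem O (foreach 5 (fun b => Push 1 b ;; Push 6 b))
    [:: a0; b1; a2; a3; a4; a5; b6; a7; a8; a9] =
    [:: a0; catrev a5 b1; a2; a3; a4; [::]; catrev a5 b6; a7; a8; a9].
    elim: a5 b1 b6 {v H1} => [|[] w IH] b c;
    by rewrite sem_loop //= !semE /= IH.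
  by rewrite F /= catrevE cats0 size_rev.
have H3 b1' : cost O (copy 4) [:: a0; b1'; a2; a3; a4; a5; [::]; a7; a8; a9]
   <= 14 * size a4 + 2.
  apply: (copyE 4) => //.
  have F b1 b6 : sem O (foreach 4 (fun b => Push 1 b ;; Push 6 b))
    [:: a0; b1; a2; a3; a4; a5; b6; a7; a8; a9] =
    [:: a0; catrev a4 b1; a2; a3; [::]; a5; catrev a4 b6; a7; a8; a9].
    elim: a4 b1 b6 {H1 H2} => [|[] w IH] b c;
    by rewrite sem_loop //= !semE /= IH.
  by rewrite F /= catrevE cats0 size_rev.
have := H3 [:: true, false, false & v]; rewrite cost_ask.
by move: H1 H2; do 3!move: (cost O _ _) => ?; lia.
Qed.

Lemma loop_free_read_frac k : loop_free (read_frac k).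
Proof. by elim: k => //= k ->. Qed.

Lemma cost_read_atom k a0 a2 a3 a4 a5 a7 a8 a9 :
  cost O (read_atom k) [:: a0; [::]; a2; a3; a4; a5; [::]; a7; a8; a9]
  <= 5 * size a3 + 14 * (size a4 + size a5) + length_of (read_answer k) + 30.
Proof.
rewrite /read_atom 4!cost_comp.
have -> : sem O (pop 3) [:: a0; [::]; a2; a3; a4; a5; [::]; a7; a8; a9] =
   [:: a0; [::]; a2; behead a3; a4; a5; [::]; a7; a8; a9].
  by rewrite sem_case /=; case: (a3) => [|[] r].
rewrite sem_scan_skip sem_query.
have H1 : cost O (pop 3) [:: a0; [::]; a2; a3; a4; a5; [::]; a7; a8; a9] <= 4.
  exact: (@cost_loop_free O (pop 3)).
have H2 := @cost_scan 3 (fun=> Skip)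
  [:: a0; [::]; a2; behead a3; a4; a5; [::]; a7; a8; a9] isT isT isT isT.
have H3 := cost_query a0 a2 (chunk (behead a3)).2 a4 a5 a7 a8 a9.
have lf : loop_free (read_answer k) by rewrite /= loop_free_read_frac.
have H4 s := @cost_loop_free O (read_answer k) s lf.
have H5 s : cost O (pushes 4 (nseq 4 true)) s <= 9.
  exact: (@cost_loop_free O (pushes 4 (nseq 4 true))).
apply: leq_trans (leq_add H1 (leq_add H2 (leq_add H3
  (leq_add (H4 _) (H5 _))))) _.
rewrite [get _ _]/= size_behead; move: (length_of (read_answer k)) => ?.
by rewrite /=; lia.
Qed.

(** The bound [m] is on a potential: an atom adds four cells to stack 4 and removes at least one
    from stack 3, so all queries stay short. The answers cost a constant, since [read_answer k] is
    loop-free. *)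
Lemma cost_read_matrix k a0 a2 a3 a4 a5 a7 a8 a9 m n :
  size a3 <= n -> size a4 + 4 * size a3 <= m ->
  size (get (sem O (read_matrix k)
    [:: a0; [::]; a2; a3; a4; a5; [::]; a7; a8; a9]) 8)
  <= size a8 + 2 * size a3 /\
  cost O (read_matrix k) [:: a0; [::]; a2; a3; a4; a5; [::]; a7; a8; a9]
  <= size a3
     * (5 * n + 14 * (m + size a5) + length_of (read_answer k) + 31) + 1.
Proof.
have np : nopush 3 (read_atom k) by rewrite /= nopush_read_frac.
set B := 5 * n + _ + _ + 31.
have [i] := ubnP (size a3).
elim: i a2 a3 a4 a8 => // i IH a2 a3 a4 a8 lt_i le3 le4.
rewrite /read_matrix sem_loop // cost_loop // -/(read_matrix k).
case: a3 lt_i le3 le4 => [|[] r] lt_i le3 le4 /=.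
- by split; rewrite ?muln0 ?addn0.
- have [r' [a8' [H lr l8]]] : exists r' a8', [/\ sem O read_connective
      [:: a0; [::]; a2; r; a4; a5; [::]; a7; a8; a9] =
      [:: a0; [::]; a2; r'; a4; a5; [::]; a7; a8'; a9], size r' <= size r &
      size a8' <= size a8 + 2].
    case: (r) => [|b r'].
      by exists [::], a8; split=> //; rewrite leq_addr.
    by exists r', [:: true, b & a8]; split; rewrite //= ?addn2 //; case: b.
  have hc : cost O read_connective
      [:: a0; [::]; a2; r; a4; a5; [::]; a7; a8; a9] <= 12.
    exact: (@cost_loop_free O read_connective).
  rewrite H; move: lt_i le3 le4 => /= lt_i le3 le4.
  have [|||h8 hc'] := IH a2 r' a4 a8'; [lia | lia | lia |].
  split; first by lia.
  have hB : 31 <= B by rewrite leq_addl.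
  have := leq_mul lr (leqnn B); rewrite mulSn.
  by move: hc hc'; do 2!move: (cost O _ _) => ?; move: (size r * B); lia.
- have [b2 H] := sem_read_atom O k a0 a2 r a4 a5 a7 a8 a9.
  have hc := cost_read_atom k a0 a2 r a4 a5 a7 a8 a9.
  set r' := (chunk (behead r)).2 in H; set a8' := [:: false, _ & a8] in H.
  have lr : size r' <= size r.
    apply: leq_trans (leq_trans (leq_addl _ _) (size_chunk _)) _.
    by rewrite size_behead leq_pred.
  rewrite H; move: lt_i le3 le4 => /= lt_i le3 le4.
  have [|||h8 hc'] := IH b2 r' (nseq 4 true ++ a4) a8'.
  - by lia.
  - by lia.
  - by rewrite size_cat /=; lia.
  split; first by apply: leq_trans h8 _; rewrite /a8' /=; move: lr; lia.
  have hB : cost O (read_atom k) [:: a0; [::]; a2; r; a4; a5; [::]; a7; a8; a9]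
    < B by rewrite /B; move: hc; move: (cost O _ _) (length_of _) => ? ?; lia.
  have := leq_mul lr (leqnn B); rewrite mulSn.
  by move: hB hc'; do 2!move: (cost O _ _) => ?; move: (size r * B); lia.
Qed.

Lemma cost_read_prefix i a0 a3 a4 :
  (exists b0 b3 b5 b7 l',
  [/\ sem O (read_prefix i)
        [:: a0; [::]; [::]; a3; a4; [::]; [::]; [::]; [::]; [::]] =
      [:: b0; [::]; [::]; b3; a4; b5; [::]; b7; [::]; [:: l']],
      size b0 <= size a0, size b3 <= size a3 &
      size b5 <= size a3 * (4 * size a0 + 6) + (2 * i + 2)]) /\
  cost O (read_prefix i)
    [:: a0; [::]; [::]; a3; a4; [::]; [::]; [::]; [::]; [::]]
  <= size a3 * (40 * size a0 + 10 * size a3 + 61) + 4 * i + 12.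
Proof.
set w := false :: sd (nseq i true).
have sw : size w = 2 * i + 2.
  by rewrite /w /= size_sd size_nseq; lia.
rewrite /read_prefix -/w 3!sem_comp 3!cost_comp cost_push.
rewrite [sem O (Push 9 false) _]/=.
have [[b0 [b3 [b5 [b7 [l' [H h0 h3 h5]]]]]] hc] := @cost_read_quantifiers
  false a0 [::] [::] a3 a4 [::] [::] [::] (size a0) (size a3)
  (leqnn _) (leq0n _) (leqnn _).
rewrite [sem O (Push 9 false) _](_ : _ =
  [:: a0; [::]; [::]; a3; a4; [::]; [::]; [::]; [::]; [:: false]]) // H.
have -> : sem O (pop 3)
  [:: b0; [::]; [::]; b3; a4; b5; [::]; b7; [::]; [:: l']] =
  [:: b0; [::]; [::]; behead b3; a4; b5; [::]; b7; [::]; [:: l']].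
  by case: (b3) => [|[] ?].
rewrite sem_pushes //=; split.
  exists b0, (behead b3), (catrev w b5), b7, l'; split=> //.
    by apply: leq_trans h3; rewrite size_behead leq_pred.
  by rewrite catrevE size_cat size_rev sw; move: h5 => /=; lia.
have h1 s : cost O (pop 3) s <= 4 by apply: (@cost_loop_free O (pop 3)).
have h2 s : cost O (pushes 5 w) s <= 4 * i + 5.
  apply: leq_trans (_ : length_of (pushes 5 w) <= _).
    by apply: cost_loop_free; elim: (w).
  by rewrite length_pushes sw; lia.
apply: leq_trans (leq_add (leqnn _) (leq_add hc (leq_add (h1 _) (h2 _)))) _.
by lia.
Qed.

(** Here [8 * n + 2] bounds the initial potential of [cost_read_matrix]: [4 * n + 2] cells for the
    twice coded sentence and four for each remaining cell of stack 3. The term with [2 * k + 4]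
    bounds stack 5, that is, the point and the precision. *)
Definition time_bound (k n : nat) : nat :=
  100 + 4 * k + 200 * n + n * (50 * n + 61)
  + n * (5 * n + 14 * ((8 * n + 2) + (n * (4 * n + 6) + (2 * k + 4)))
         + length_of (read_answer k) + 31).

Lemma cost_decide k w :
  cost O (decide k) (w :: nseq 9 [::]) <= time_bound k (size w).
Proof.
rewrite /decide 5!cost_comp sem_read_sentence.
have hA := cost_read_sentence w.
set x := (chunk w).1; set r := (chunk w).2.
have hw : size x + size r <= size w := size_chunk w.
set p := catrev _ [::].
have hp : size p = 4 * size x + 2.
  by rewrite /p catrevE cats0 size_rev size_cat !size_dbl /=; lia.
have [[b0 [b3 [b5 [b7 [l [-> h0 h3 h5]]]]]] hB] := cost_read_prefix k.+1 r x p.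
have [h8 hC] := @cost_read_matrix k b0 [::] b3 p b5 b7 [::] [:: l]
  (8 * size w + 2) (size w) ltac:(lia) ltac:(lia).
set s3 := sem O (read_matrix k) _ in h8 *.
have hs0 : size (get s3 0) <= size b0.
  by apply: (@sem_nopush O 0 (read_matrix k)); rewrite /= nopush_read_frac.
have hD : cost O evaluate s3 <= size (get s3 8) * 51 + 1.
  apply: cost_loop_const => // s.
    by apply: leq_trans (cost_loop_free _ _ _) _.
  by apply: leq_trans (cost_loop_free _ _ _) _.
set s4 := sem O evaluate s3.
have hs4 : size (get s4 0) <= size (get s3 0) by apply: sem_nopush.
have hE := @cost_foreach 0 (fun=> Skip) s4 isT isT isT isT.
have hF s : cost O (Case 9 Skip Skip (Push 0 true)) s <= 5.
  exact: (@cost_loop_free O (Case 9 Skip Skip (Push 0 true))).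
apply: leq_trans (leq_add hA (leq_add hB (leq_add hC (leq_add hD
  (leq_add hE (hF _)))))) _.
rewrite /time_bound; move: (length_of (read_answer k)) => len.
rewrite [length_of _]/= in h8 *.
have hr : size r <= size w by lia.
have hx : size x <= size w by lia.
have i1 : size x * (40 * size r + 10 * size x + 61)
  <= size w * (50 * size w + 61) by apply: leq_mul => //; lia.
have i2 : size b5 <= size w * (4 * size w + 6) + (2 * k + 4).
  apply: leq_trans h5 _; rewrite leq_add //; last by lia.
  by apply: leq_mul => //; lia.
have i3 : size b3 * (5 * size w + 14 * (8 * size w + 2 + size b5) + len + 31)
  <= size w * (5 * size w + 14 * ((8 * size w + 2)
     + (size w * (4 * size w + 6) + (2 * k + 4))) + len + 31).
  apply: leq_mul; first by lia.
  by move: i2; move: (size w * (4 * size w + 6)) => ?; lia.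
have i4 : size (get s4 0) <= size w by lia.
have i5 : size (get s3 8) <= 2 * size w by move: h8 => /=; lia.
move: i1 i3 i4 i5; rewrite /=.
move: (_ * (_ + 61)) (_ * (_ + 61)) (_ * (_ + 31)) (_ * (_ + 31)).
by move=> ? ? ? ?; lia.
Qed.

End Cost.

(** * Polynomials with natural coefficients *)

Definition is_polynomial (f : nat -> nat) : Prop :=
  exists p : {poly nat}, forall n, f n = p.[n]%R.

Lemma polynomial_const c : is_polynomial (fun=> c).
Proof. by exists (c%:P)%R => n; rewrite hornerC. Qed.

Lemma polynomial_id : is_polynomial id.
Proof. by exists 'X%R => n; rewrite hornerX. Qed.

Lemma polynomialD f g :
  is_polynomial f -> is_polynomial g -> is_polynomial (fun n => f n + g n).
Proof.
by move=> [p hp] [q hq]; exists (p + q)%R => n; rewrite hornerD hp hq.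
Qed.

Lemma polynomialM f g :
  is_polynomial f -> is_polynomial g -> is_polynomial (fun n => f n * g n).
Proof.
by move=> [p hp] [q hq]; exists (p * q)%R => n; rewrite hornerM hp hq.
Qed.

Lemma polynomial_comp (p : {poly nat}) f :
  is_polynomial f -> is_polynomial (fun n => p.[f n])%R.
Proof.
move=> hf; elim/poly_ind: p => [|p c [q hq]].
  by exists 0%R => n; rewrite !horner0.
have [r hr] := polynomialD (polynomialM (ex_intro _ q hq) hf)
                           (polynomial_const c).
by exists r => n; rewrite -hr hornerMXaddC.
Qed.

Lemma horner_nat_le (p : {poly nat}) m n : m <= n -> (p.[m])%R <= (p.[n])%R.
Proof.
move=> le_mn; elim/poly_ind: p => [|p c IH]; first by rewrite !horner0.
by rewrite !hornerMXaddC leq_add2r leq_mul.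
Qed.

Lemma polynomial_time_bound k : is_polynomial (time_bound k).
Proof.
by rewrite /time_bound; repeat first
  [ exact: polynomial_const | exact: polynomial_id
  | apply: polynomialD | apply: polynomialM ].
Qed.

(** * Blocks of quantifiers *)

Section Words.

Variable T : seq word -> Prop.

(** One quantifier per variable, with a separate range for each player: soundness restricts only the
    universal words to length [L], completeness only the existential ones. *)
Fixpoint word_game (De Da : word -> Prop) (qs : seq bool) (us : seq word) :
  Prop :=
  if qs is q :: qs' then
    if q then exists2 u, De u & word_game De Da qs' (rcons us u)
    else forall u, Da u -> word_game De Da qs' (rcons us u)
  else T us.

Lemma word_game_ex De Da k qs us :
  word_game De Da (nseq k true ++ qs) us <->
  exists us', [/\ size us' = k, (forall u, u \in us' -> De u) &
                  word_game De Da qs (us ++ us')].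
Proof.
elim: k us => [|k IH] us /=.
  split=> [h|[us' [/size0nil->]]]; last by rewrite cats0.
  by exists [::]; rewrite cats0.
split=> [[u hu /IH[us' [sz hus' h]]]|[us' [sz hus' h]]].
  exists (u :: us'); split=> /= [|v|]; first by rewrite sz.
    by rewrite inE => /predU1P[->//|]; apply: hus'.
  by rewrite -cat_rcons.
case: us' sz hus' h => // u us' [sz] hus' h.
exists u; first by apply: hus'; rewrite mem_head.
apply/IH; exists us'; rewrite cat_rcons; split=> // v hv.
by apply: hus'; rewrite inE hv orbT.
Qed.

Lemma word_game_all De Da k qs us :
  word_game De Da (nseq k false ++ qs) us <->
  (forall us', size us' = k -> (forall u, u \in us' -> Da u) ->
               word_game De Da qs (us ++ us')).
Proof.
elim: k us => [|k IH] us /=.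
  split=> [h us' /size0nil->|/(_ [::])]; first by rewrite cats0.
  by rewrite cats0; apply.
split=> [h us' sz hus'|h u hu].
  case: us' sz hus' => // u us' [sz] hus'.
  rewrite -cat_rcons; apply: (IH (rcons us u)).1 => //.
    by apply: h; apply: hus'; rewrite mem_head.
  by move=> v hv; apply: hus'; rewrite inE hv orbT.
apply/IH=> us' sz hus'; rewrite cat_rcons; apply: h; first by rewrite /= sz.
by move=> v; rewrite inE => /predU1P[->//|]; apply: hus'.
Qed.

Fixpoint chunks (k : nat) (y : word) : seq word :=
  if k is k'.+1 then (chunk y).1 :: chunks k' (chunk y).2 else [::].

Fixpoint rest (k : nat) (y : word) : word :=
  if k is k'.+1 then rest k' (chunk y).2 else y.

Lemma size_chunks k y : size (chunks k y) = k.
Proof. by elim: k y => //= k IH y; rewrite IH. Qed.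

Lemma chunks_enc_words us : chunks (size us) (enc_words us) = us.
Proof.
elim: us => //= u us IH.
by rewrite /enc_words /= chunk_sd /= -/(enc_words us) IH.
Qed.

Lemma decode_same q y ys k qs :
  decode q y ys (nseq k q ++ qs) = chunks k y ++ decode q (rest k y) ys qs.
Proof. by elim: k y => //= k IH y; rewrite eqxx IH. Qed.

(** The preceding kind is [~~ q], so the first quantifier of the block fetches a fresh word and the
    others read on in it. *)
Lemma decode_block q y ys k qs :
  decode (~~ q) y ys (nseq k.+1 q ++ qs) =
  chunks k.+1 (head [::] ys)
  ++ decode q (rest k.+1 (head [::] ys)) (behead ys) qs.
Proof. by case: q; rewrite /= decode_same. Qed.

Lemma size_enc_words_le us L :
  (forall u, u \in us -> size u <= L) ->
  size (enc_words us) <= size us * (2 * L + 1).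
Proof.
elim: us => //= u us IH h; rewrite /enc_words /= size_cat mulSn leq_add //.
  by rewrite size_sd; have := h u (mem_head _ _); lia.
by apply: IH => v hv; apply: h; rewrite inE hv orbT.
Qed.

Definition flags (k : nat -> nat) (s n : nat) : seq bool :=
  flatten [seq nseq (k i).+1 (~~ odd i) | i <- iota s n].

Section Blocks.

Variables (k : nat -> nat) (L b : nat).

Lemma block_size s n :
  size (flags k s n.+1) = (k s).+1 + size (flags k s.+1 n).
Proof. by rewrite /flags /= size_cat size_nseq. Qed.

Lemma alternation_ext (ex : bool) n (P P' : seq word -> Prop) ys :
  (forall zs, P (ys ++ zs) -> P' (ys ++ zs)) ->
  alternation ex n b P ys -> alternation ex n b P' ys.
Proof.
elim: n ex ys => [|n IH] ex ys h /=; first by have := h [::]; rewrite cats0.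
have h' y : alternation (~~ ex) n b P (rcons ys y) ->
            alternation (~~ ex) n b P' (rcons ys y).
  by apply: IH => zs; rewrite cat_rcons; apply: h.
by case: ex {h} h' => h'; [case=> y hy /h'; exists y | move=> H y /H/h'].
Qed.

Lemma decode_flags s n y0 y ys zs :
  decode (odd s) y0 (drop (size ys) (rcons ys y ++ zs)) (flags k s n.+1)
  = chunks (k s).+1 y
    ++ decode (odd s.+1) (rest (k s).+1 y)
         (drop (size (rcons ys y)) (rcons ys y ++ zs)) (flags k s.+1 n).
Proof.
rewrite [drop (size (rcons _ _)) _]drop_size_cat // cat_rcons drop_size_cat //.
by rewrite -{1}[odd s]negbK; apply: decode_block.
Qed.

(** An existential word is unpacked into chunks about whose length nothing is claimed. Universal
    words of length at most [L] have to be packed into one word; each takes at most [2 * L + 1]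
    bits, whence the condition on [b]. *)
Lemma alternation_word_game n s us y0 ys :
  size (flags k s n) * (2 * L + 1) <= b ->
  alternation (~~ odd s) n b
    (fun zs => T (us ++ decode (odd s) y0 (drop (size ys) zs) (flags k s n)))
    ys ->
  word_game (fun=> True) (fun u => size u <= L) (flags k s n) us.
Proof.
elim: n s us y0 ys => [|n IH] s us y0 ys; first by rewrite /= cats0.
rewrite block_size => hb.
have hb' : size (flags k s.+1 n) * (2 * L + 1) <= b by lia.
have next y : alternation (odd s) n b
    (fun zs => T (us ++ decode (odd s) y0 (drop (size ys) zs)
                          (flags k s n.+1))) (rcons ys y) ->
  word_game (fun=> True) (fun u => size u <= L) (flags k s.+1 n)
    (us ++ chunks (k s).+1 y).
  move=> h; apply: (IH s.+1 _ (rest (k s).+1 y) (rcons ys y)) => //.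
  rewrite [~~ odd _]negbK; apply: alternation_ext h => zs.
  by rewrite decode_flags catA.
rewrite -[flags k s n.+1]/(nseq (k s).+1 (~~ odd s) ++ flags k s.+1 n)
  in next *.
case: (odd s) next => next H.
  apply/(word_game_all _ _ (k s).+1) => us' sz hus'.
  have E := chunks_enc_words us'; rewrite sz in E.
  have := next (enc_words us'); rewrite E; apply.
  apply: (H (enc_words us')); apply: leq_trans (size_enc_words_le hus') _.
  by rewrite sz; apply: leq_trans hb; rewrite leq_mul2r leq_addr orbT.
apply/(word_game_ex _ _ (k s).+1); have [y _ {}H] := H.
by exists (chunks (k s).+1 y); rewrite size_chunks; split=> //; apply: next.
Qed.

(** Dual to the previous lemma: existential words are packed, universal ones unpacked. *)
Lemma word_game_alternation n s us y0 ys :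
  size (flags k s n) * (2 * L + 1) <= b ->
  word_game (fun u => size u <= L) (fun=> True) (flags k s n) us ->
  alternation (~~ odd s) n b
    (fun zs => T (us ++ decode (odd s) y0 (drop (size ys) zs) (flags k s n)))
    ys.
Proof.
elim: n s us y0 ys => [|n IH] s us y0 ys; first by rewrite /= cats0.
rewrite block_size => hb.
have hb' : size (flags k s.+1 n) * (2 * L + 1) <= b by lia.
have next y : word_game (fun u => size u <= L) (fun=> True) (flags k s.+1 n)
    (us ++ chunks (k s).+1 y) ->
  alternation (odd s) n b
    (fun zs => T (us ++ decode (odd s) y0 (drop (size ys) zs)
                          (flags k s n.+1))) (rcons ys y).
  move=> h; have := IH s.+1 _ (rest (k s).+1 y) (rcons ys y) hb' h.
  rewrite [~~ odd _]negbK; apply: alternation_ext => zs.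
  by rewrite decode_flags catA.
rewrite -[flags k s n.+1]/(nseq (k s).+1 (~~ odd s) ++ flags k s.+1 n)
  in next *.
case: (odd s) next => next H.
  move=> y _; apply: next.
  by apply: (word_game_all _ _ (k s).+1 _ _).1 H _ _ _; rewrite ?size_chunks.
have [us' [sz hus' h]] := (word_game_ex _ _ (k s).+1 _ _).1 H.
exists (enc_words us').
  apply: leq_trans (size_enc_words_le hus') _.
  by rewrite sz; apply: leq_trans hb; rewrite leq_mul2r leq_addr orbT.
have E := chunks_enc_words us'; rewrite sz in E.
by apply: next; rewrite E.
Qed.

End Blocks.

End Words.

(** * Dyadic points and terms *)

Local Open Scope ring_scope.

Section Dyadics.

Variable R : realType.

Definition frac_value (u : word) : R := dval R (frac_dyadic u).

Lemma foldl_bits a (u : word) :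
  foldl (fun a (b : bool) => a.*2 + b)%N a u =
  (a * 2 ^ size u + foldl (fun a (b : bool) => a.*2 + b)%N 0%N u)%N.
Proof.
elim: u a => [|b u IH] a /=; first by rewrite muln1 addn0.
by rewrite IH [in RHS]IH expnS; lia.
Qed.

Lemma frac_value_nil : frac_value [::] = 0.
Proof. by rewrite /frac_value /dval /= !mulr0 mul0r. Qed.

Lemma frac_value_cons b u : frac_value (b :: u) = (b%:R + frac_value u) / 2.
Proof.
rewrite /frac_value /dval /= !expr0 !mul1r foldl_bits natrD natrM natrX exprS.
rewrite double0 add0n invfM mulrDl.
have /mulfV h : (2 : R) ^+ size u != 0 by rewrite expf_neq0 // pnatr_eq0.
by rewrite mulrA [_ * 2^-1]mulrC -!mulrA h; ring.
Qed.

Lemma frac_value_ge0 u : 0 <= frac_value u.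
Proof.
elim: u => [|b u IH]; first by rewrite frac_value_nil.
by rewrite frac_value_cons divr_ge0 // addr_ge0.
Qed.

Lemma frac_value_lt1 u : frac_value u < 1.
Proof.
elim: u => [|b u IH]; first by rewrite frac_value_nil ltr01.
by rewrite frac_value_cons; case: b => /=; lra.
Qed.

(** Binary expansion digit by digit. The bound is attained at [x = 1], whose best approximation
    consists of ones only. *)
Lemma frac_value_dense (x : R) n : 0 <= x <= 1 ->
  exists2 u, size u = n & `|x - frac_value u| <= 2 ^- n.
Proof.
elim: n x => [|n IH] x /andP[x0 x1].
  by exists [::] => //; rewrite frac_value_nil subr0 expr0 invr1 ger0_norm.
have [b hb] : exists b : bool, 0 <= 2 * x - b%:R <= 1.
  have [lt|ge] := ltP x (1 / 2); first by exists false => /=; lra.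
  by exists true => /=; lra.
have [u su hu] := IH _ hb; exists (b :: u); first by rewrite /= su.
rewrite frac_value_cons exprS invfM.
have -> : x - (b%:R + frac_value u) / 2
          = 2^-1 * (2 * x - b%:R - frac_value u) by field.
by rewrite normrM ger0_norm ?invr_ge0 // ler_pM2l // invr_gt0.
Qed.

(** If the first [k] digits vanish, the remaining ones contribute less than [2 ^- k]; otherwise a
    single digit already contributes that much. *)
Lemma has_true_sd k u : has_true k (sd u) = (2 ^- k <= frac_value u).
Proof.
elim: k u => [|k IH] u /=.
  by rewrite expr0 invr1; apply/esym/negbTE; rewrite -ltNge frac_value_lt1.
case: u => [|b u].
  rewrite frac_value_nil; apply/esym/negbTE; rewrite -ltNge invr_gt0.
  by rewrite exprn_gt0.
rewrite sd_cons frac_value_cons exprS invfM mulrC ler_pM2r ?invr_gt0 //.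
case: b => /=; last by rewrite add0r IH.
apply/esym; rewrite (@le_trans _ _ 1) // ?lerDl ?frac_value_ge0 //.
by rewrite invf_le1 ?exprn_gt0 // exprn_ege1 // ler1n.
Qed.

Lemma accepted_dyadic k d : accepted k (enc_dyadic d) = (2 ^- k <= dval R d).
Proof.
have hk : (0 : R) < 2 ^- k by rewrite invr_gt0 exprn_gt0.
case: d => [[] di df hd]; rewrite /enc_dyadic /=.
  apply/esym/negbTE; rewrite -ltNge; apply: le_lt_trans hk.
  by rewrite /dval /= expr1 mulN1r mulNr oppr_le0 divr_ge0 // exprn_ge0.
case: di hd => [|[] di] //= hd; first exact: has_true_sd.
apply/esym; apply: (@le_trans _ _ 1).
  by rewrite invf_le1 ?exprn_gt0 // exprn_ege1 // ler1n.
rewrite /dval /= expr0 mul1r ler_pdivlMr ?exprn_gt0 // mul1r -natrX ler_nat.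
(* The leading [true] alone contributes at least [2 ^ size df]. *)
rewrite foldl_bits size_cat mul1n; apply: leq_trans (leq_addr _ _).
by rewrite leq_exp2l // leq_addl.
Qed.

Lemma exists_small_power (x : R) : 0 < x -> exists k, 2 ^- k <= x.
Proof.
move=> x0; exists (Num.bound x^-1); rewrite invf_ple ?posrE ?exprn_gt0 //.
have /archi_boundP/ltW/le_trans-> // : 0 <= x^-1 by rewrite invr_ge0 ltW.
by rewrite -natrX ler_nat ltnW // ltn_expl.
Qed.

End Dyadics.

(** * Terms under the substitution into the unit cube *)

Section Evaluation.

Variable R : realType.

Lemma onth_nth (e : seq R) i : (i < size e)%N -> onth e i = Some (nth 0 e i).
Proof. by elim: e i => [|x e IH] [|i] //=; apply: IH. Qed.

Lemma onth_rcons (e : seq R) x : onth (rcons e x) (size e) = Some x.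
Proof. by elim: e. Qed.

(** Only defined values persist: a longer environment may give a value to a variable that had
    none. *)
Lemma eval_rcons (F : signature R) z c (t : term F) a :
  eval z t = Some a -> eval (rcons z c) t = Some a.
Proof.
elim: t a => [i|q|s IH|s1 IH1 s2 IH2|s IH|f args IH] a /=.
- by elim: z i => [|x z IH] [|i] //=; apply: IH.
- by [].
- by case E: (eval z s) => [b|] //= <-; rewrite (IH _ E).
- case E1: (eval z s1) => [b1|] //; case E2: (eval z s2) => [b2|] //.
  by rewrite (IH1 _ E1) (IH2 _ E2).
- by case E: (eval z s) => [b|] //= <-; rewrite (IH _ E).
- case: forallP => // h.
  have E i : eval (rcons z c) (args i) = eval z (args i).
    by have := h i; case E: (eval z (args i)) => [b|] // _; apply: IH.
  have -> : [forall i, eval (rcons z c) (args i)].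
    by apply/forallP=> i; rewrite E.
  by move=> <-; congr (interp _); apply: eq_mktuple => i; rewrite E.
Qed.

Variable F : signature R.

(** Links the two readings of a play: [z] lists coordinates in the unit cube, [e] the values of the
    original variables, and [sg] computes the latter from the former. *)
Definition instance (z : seq R) (sg : seq (term (with_mul F))) (e : seq R) :=
  [/\ size sg = size e, size z = size e &
      forall i, (i < size e)%N ->
        eval z (nth (Var i) sg i) = Some (nth 0 e i)].

Lemma eval_term_subst z sg e (t : term F) :
  instance z sg e -> vars_below (size sg) t ->
  eval z (tsubst sg t) = eval e t.
Proof.
move=> [ssg sz h]; elim: t => [i|q|s IH|s1 IH1 s2 IH2|s IH|f args IH] //=.
- by rewrite ssg => lt_i; rewrite h // onth_nth.
- by move=> /IH->.
- by move=> /andP[/IH1-> /IH2->].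
- by move=> /IH->.
- move=> /forallP hv.
  have E i : eval z (tsubst sg (args i)) = eval e (args i) by apply: IH.
  have -> : [forall i, eval z (tsubst sg (args i))]
            = [forall i, eval e (args i)].
    by apply: eq_forallb => i; rewrite E.
  by under eq_mktuple do rewrite E.
Qed.

Lemma eval_Mul z (s t : term (with_mul F)) a b :
  eval z s = Some a -> eval z t = Some b -> eval z (Mul s t) = Some (a * b).
Proof.
move=> hs ht; rewrite /Mul /=.
have -> : [forall i : 'I_2, eval z (if i == ord0 then s else t)].
  by apply/forallP=> i; case: ifP; rewrite ?hs ?ht.
by rewrite !tnth_mktuple /= hs ht.
Qed.

Lemma instance_rcons z sg e (Q : bquant F) a b c :
  instance z sg e -> vars_below (size sg) (qlo Q) ->
  vars_below (size sg) (qhi Q) ->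
  eval e (qlo Q) = Some a -> eval e (qhi Q) = Some b ->
  instance (rcons z c)
    (rcons sg (Add (tsubst sg (qlo Q))
       (Mul (Add (tsubst sg (qhi Q)) (Opp (tsubst sg (qlo Q))))
            (Var (size sg)))))
    (rcons e (a + (b - a) * c)).
Proof.
move=> inst vlo vhi ha hb; have [ssg sz h] := inst.
split; rewrite ?size_rcons ?ssg ?sz // => i; rewrite ltnS leq_eqVlt.
rewrite !nth_rcons ssg => /predU1P[->|lt_i]; last first.
  by rewrite lt_i; apply: eval_rcons; apply: h.
rewrite ltnn eqxx.
have ea : eval (rcons z c) (tsubst sg (qlo Q)) = Some a.
  by apply: eval_rcons; rewrite (eval_term_subst inst).
have eb : eval (rcons z c) (tsubst sg (qhi Q)) = Some b.
  by apply: eval_rcons; rewrite (eval_term_subst inst).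
have ec : @eval R (with_mul F) (rcons z c) (Var (size e)) = Some c.
  by rewrite /= -sz onth_rcons.
have ed : eval (rcons z c)
  (Add (tsubst sg (qhi Q)) (Opp (tsubst sg (qlo Q)))) = Some (b - a).
  by rewrite /= ea eb.
have em := eval_Mul ed ec.
by rewrite [LHS]/= -/(Mul _ _) ea; move: em => /= ->.
Qed.

Lemma atoms_msubst sg (psi : matrix_form F) :
  atoms (msubst sg psi) = map (tsubst sg) (atoms psi).
Proof. by elim: psi => //= p -> q ->; rewrite map_cat. Qed.

(** An accepted atom is strictly positive, which serves both kinds of atoms. A rejected atom may
    still be true; this is harmless because the matrix is positive. *)
Lemma mvalue_holds (ans : nat -> bool) j (psi : matrix_form F) e :
  (forall i, (i < size (atoms psi))%N ->
     exists2 a, eval e (nth (Cst 0) (atoms psi) i) = Some a &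
                (ans (j + i)%N -> 0 < a)) ->
  mvalue ans j psi -> matrix_holds e psi.
Proof.
have F0 m i : (m + i < m)%N = false by lia.
elim: psi j => [t|t|p IHp q IHq|p IHp q IHq] j /= h.
- by have [a E ha] := h 0%N isT; rewrite addn0 in ha; move=> /ha; exists a.
- by have [a E ha] := h 0%N isT; rewrite addn0 in ha; move=> /ha/ltW; exists a.
- move=> /andP[hp hq]; split.
    apply: (IHp j) => // i lt_i; have := h i; rewrite size_cat nth_cat lt_i.
    by apply; rewrite ltn_addr.
  apply: IHq hq => i lt_i; have := h (size (atoms p) + i)%N.
  rewrite size_cat nth_cat F0 addKn addnA; apply.
  by rewrite ltn_add2l.
- move=> /orP[hp|hq]; [left | right].
    apply: (IHp j) => // i lt_i; have := h i; rewrite size_cat nth_cat lt_i.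
    by apply; rewrite ltn_addr.
  apply: IHq hq => i lt_i; have := h (size (atoms p) + i)%N.
  rewrite size_cat nth_cat F0 addKn addnA; apply.
  by rewrite ltn_add2l.
Qed.

Lemma holds_mvalue dlt (ans : nat -> bool) j (psi : matrix_form F) e :
  (forall i a, (i < size (atoms psi))%N ->
     eval e (nth (Cst 0) (atoms psi) i) = Some a -> ratr dlt <= a ->
     ans (j + i)%N) ->
  matrix_holds e (strengthen_matrix dlt psi) -> mvalue ans j psi.
Proof.
have F0 m i : (m + i < m)%N = false by lia.
elim: psi j => [t|t|p IHp q IHq|p IHp q IHq] j /= h.
- case=> a; case E: (eval e t) => [b|] //= [<-]; rewrite subr_gt0 => /ltW hb.
  by rewrite -(addn0 j); apply: h hb.
- case=> a; case E: (eval e t) => [b|] //= [<-]; rewrite subr_ge0 => hb.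
  by rewrite -(addn0 j); apply: h hb.
- case=> hp hq; apply/andP; split.
    apply: IHp hp => i a lt_i; have := h i a; rewrite size_cat nth_cat lt_i.
    by apply; rewrite ltn_addr.
  apply: IHq hq => i a lt_i; have := h (size (atoms p) + i)%N a.
  rewrite size_cat nth_cat F0 addKn addnA; apply.
  by rewrite ltn_add2l.
- case=> hp; apply/orP; [left | right].
    apply: IHp hp => i a lt_i; have := h i a; rewrite size_cat nth_cat lt_i.
    by apply; rewrite ltn_addr.
  apply: IHq hp => i a lt_i; have := h (size (atoms p) + i)%N a.
  rewrite size_cat nth_cat F0 addKn addnA; apply.
  by rewrite ltn_add2l.
Qed.

End Evaluation.

(** * The quantifier game *)

Section Game.

Variables (R : realType) (F : signature R).

Lemma unit_coordinate (a b x : R) : a <= x <= b ->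
  exists2 c, 0 <= c <= 1 & x = a + (b - a) * c.
Proof.
move=> /andP[ax xb]; have := le_trans ax xb.
rewrite le_eqVlt => /predU1P[ab|ab].
  (* In a degenerate interval the quotient below would divide by zero; every coordinate yields the
     only point. *)
  exists 0; first by rewrite lexx ler01.
  by rewrite mulr0 addr0; apply/eqP; rewrite eq_le ax {1}ab xb.
have ab0 : 0 < b - a by rewrite subr_gt0.
exists ((x - a) / (b - a)).
  rewrite divr_ge0 ?subr_ge0 ?(ltW ab) //= ler_pdivrMr // mul1r.
  by rewrite lerD2r.
by rewrite mulrC divfK ?gt_eqF // subrKC.
Qed.

Lemma in_bounds_unit (a b c : R) : a <= b -> 0 <= c <= 1 ->
  a <= a + (b - a) * c <= b.
Proof. by move=> ab /andP[c0 c1]; apply/andP; split; nra. Qed.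

Variables (eps : R) (L : nat).
Hypothesis heps : 2 ^- L < eps.

(** A move made in both games at once: a real coordinate and the digit word played for it. *)
Definition tracks (p : R * word) : bool :=
  (0 <= p.1 <= 1) && (`|p.1 - frac_value R p.2| < eps).

Lemma tracks_frac u : tracks (frac_value R u, u).
Proof.
rewrite /tracks /= frac_value_ge0 ltW ?frac_value_lt1 // subrr normr0 /=.
by apply: le_lt_trans heps; rewrite invr_ge0 exprn_ge0.
Qed.

Lemma tracks_dense c : 0 <= c <= 1 ->
  exists2 u, (size u <= L)%N & tracks (c, u).
Proof.
move=> hc; have [u su hu] := frac_value_dense L hc.
by exists u; rewrite ?su // /tracks /= hc (le_lt_trans hu).
Qed.

Variables (T : seq word -> Prop) (sgF : seq (term (with_mul F))).
Variable psi : matrix_form F.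

(** Both games are played in parallel. An existential word becomes the exact grid point that it
    denotes, a universal real is rounded to a word of length at most [L]; either way the pair
    tracks. *)
Lemma word_game_sound :
  (forall g e, all tracks g -> instance (map fst g) sgF e ->
     T (map snd g) -> matrix_holds e psi) ->
  forall qs sg g e, unit_subst qs sg = sgF ->
  instance (map fst g) sg e -> all tracks g ->
  closed_prefix (size sg) qs -> interval_prefix qs e ->
  word_game T (fun=> True) (fun u => (size u <= L)%N) (map (@qex R F) qs)
    (map snd g) ->
  prefix_holds qs psi e.
Proof.
move=> fin; elim=> [|Q qs IH] sg g e /= Esg inst hg.
  by rewrite Esg in inst *; move=> _ _; apply: fin.
move=> /and3P[vlo vhi hcl] [[x0 [a [b [ha hb /andP[ax xb]]]]] hint].
have ab := le_trans ax xb.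
have next c u : tracks (c, u) -> word_game T (fun=> True)
    (fun u => (size u <= L)%N) (map (@qex R F) qs) (rcons (map snd g) u) ->
  prefix_holds qs psi (rcons e (a + (b - a) * c)).
  move=> hcu hw; apply: (IH _ (rcons g (c, u)) _ Esg).
  - by rewrite map_rcons; exact: (instance_rcons c inst).
  - by rewrite all_rcons hcu.
  - by rewrite size_rcons.
  - apply: hint; exists a, b; split=> //; apply: in_bounds_unit => //.
    by case/andP: hcu.
  - by rewrite map_rcons.
case: (qex Q) => [[u _ hu]|h x [a' [b' [ha' hb' hx]]]].
  exists (a + (b - a) * frac_value R u).
    exists a, b; split=> //; apply: in_bounds_unit => //.
    by case/andP: (tracks_frac u).
  by apply: next hu; apply: tracks_frac.
move: ha' hb' hx; rewrite ha hb => -[<-] [<-] hx.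
have [c hc ->] := unit_coordinate hx.
have [u su hu] := tracks_dense hc.
by apply: (next c u) => //; apply: h.
Qed.

(** The rounding changes sides: existential reals are rounded to words, universal words are taken as
    exact grid points. *)
Lemma word_game_complete (psi' : matrix_form F) :
  (forall g e, all tracks g -> instance (map fst g) sgF e ->
     matrix_holds e psi' -> T (map snd g)) ->
  forall qs sg g e, unit_subst qs sg = sgF ->
  instance (map fst g) sg e -> all tracks g ->
  closed_prefix (size sg) qs -> interval_prefix qs e ->
  prefix_holds qs psi' e ->
  word_game T (fun u => (size u <= L)%N) (fun=> True) (map (@qex R F) qs)
    (map snd g).
Proof.
move=> fin; elim=> [|Q qs IH] sg g e /= Esg inst hg.
  by rewrite Esg in inst *; move=> _ _; apply: fin.
move=> /and3P[vlo vhi hcl] [[x0 [a [b [ha hb /andP[ax xb]]]]] hint].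
have ab := le_trans ax xb.
have next c u : tracks (c, u) ->
  prefix_holds qs psi' (rcons e (a + (b - a) * c)) ->
  word_game T (fun u => (size u <= L)%N) (fun=> True) (map (@qex R F) qs)
    (rcons (map snd g) u).
  move=> hcu hw; rewrite -[u]/((c, u).2) -map_rcons.
  apply: IH (Esg) _ _ _ _ hw.
  - by rewrite map_rcons; exact: (instance_rcons c inst).
  - by rewrite all_rcons hcu.
  - by rewrite size_rcons.
  - apply: hint; exists a, b; split=> //; apply: in_bounds_unit => //.
    by case/andP: hcu.
case: (qex Q) => [[x [a' [b' [ha' hb' hx]]] hp]|h u _].
  move: ha' hb' hx; rewrite ha hb => -[<-] [<-] hx.
  have [c hc E] := unit_coordinate hx.
  have [u su hu] := tracks_dense hc; exists u => //.
  by apply: (next c) => //; rewrite -E.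
apply: (next (frac_value R u)); first exact: tracks_frac.
apply: h; exists a, b; split=> //; apply: in_bounds_unit => //.
by case/andP: (tracks_frac u).
Qed.

End Game.

(** * The verifier on encoded sentences *)

Section Sentences.

Variables (R : realType) (F : signature R).
Implicit Type phi : sentence F.

Definition quantifier_codes phi : seq (bool * word * word) :=
  [seq (qex Q, enc_term (qlo Q), enc_term (qhi Q)) | Q <- qprefix phi].

Lemma enc_sentenceE phi :
  enc_sentence phi =
  flatten (map qcode (quantifier_codes phi))
  ++ false :: enc_matrix (matrix_of phi).
Proof. by rewrite /enc_sentence /quantifier_codes -map_comp. Qed.

Lemma size_atoms_le (psi : matrix_form F) :
  (size (atoms psi) <= size (enc_matrix psi))%N.
Proof. by elim: psi => //= p IHp q IHq; rewrite !size_cat; lia. Qed.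

Lemma size_sentence phi :
  (size (qprefix phi) + size (atoms (matrix_of phi))
   <= size (enc_sentence phi))%N.
Proof.
rewrite size_cat leq_add //=; last by rewrite ltnW // ltnS size_atoms_le.
by elim: (qprefix phi) => //= Q qs IH; rewrite size_cat; lia.
Qed.

(** A code [sd] doubles the length and adds one; the unary index is smaller than the number of
    atoms, hence than the code of the sentence. *)
Lemma size_term_name phi j : (j < size (atoms (matrix_of phi)))%N ->
  (size (term_name phi j) <= 4 * size (enc_sentence phi) + 2)%N.
Proof.
move=> lt_j; have := size_sentence phi; rewrite /term_name /enc_words /= cats0.
rewrite size_cat !size_sd size_nseq.
by move: (size (enc_sentence phi)) => ?; lia.
Qed.

Lemma size_unit_subst (qs : seq (bquant F)) sg :
  size (unit_subst qs sg) = (size sg + size qs)%N.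
Proof.
by elim: qs sg => [|Q qs IH] sg /=; rewrite ?addn0 ?IH ?size_rcons; lia.
Qed.

Definition atom_answer (O : word -> word) (k : nat) phi (us : seq word)
  (j : nat) : bool :=
  accepted k (O (enc_query (term_name phi j) (map frac_dyadic us) k.+1)).

Lemma accepts_decide (O : word -> word) k phi ys :
  accepts (compile 7 (decide k)) O (enc_words (enc_sentence phi :: ys)) <->
  mvalue (atom_answer O k phi
            (decode false [::] ys (map (@qex R F) (qprefix phi))))
    0 (matrix_of phi).
Proof.
have h := @compile_outputs 7 (decide k) O
  (enc_words (enc_sentence phi :: ys)) 9 (wf_decide k).
have := sem_decide O k (matrix_of phi) (quantifier_codes phi) ys.
rewrite -enc_sentenceE /quantifier_codes -map_comp => E.
set v := mvalue _ _ _; have {}E : get _ _ = nseq v true := E.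
rewrite [get _ _]E in h; split=> [[t /(outputs_within_inj h)]|hv].
  by case: (v).
by rewrite hv in h; eexists; exact: h.
Qed.

End Sentences.

(** * Error estimate for the atoms *)

Section Approximation.

Variables (R : realType) (F : signature R) (S : sentence F -> Prop).
Variables (m : {poly nat}) (theta : approx) (k : nat) (phi : sentence F).
Hypothesis htotal : total_on_cube (terms_of S).
Hypothesis hmod : is_modulus (terms_of S) (fun i => m.[i]).
Hypothesis happrox : is_approx (terms_of S) theta.
Hypotheses (hS : S phi) (hphi : closed_sentence phi).

(** The modulus is applied to the length of a term name, at most [4 * n + 2], plus the accuracy
    [k.+1]. *)
Definition precision (n : nat) : nat := m.[(4 * n + 2 + k.+1)%N].

Let eps : R := 2 ^- precision (size (enc_sentence phi)).
Let psi := matrix_of phi.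

(** The modulus contributes a strict error bound and the oracle a weak one, so the sum is strictly
    below [2 ^- k]; this makes an accepted atom strictly positive. *)
Lemma atom_approx g e j :
  all (tracks eps) g ->
  instance (map fst g) (unit_subst (qprefix phi) [::]) e ->
  (j < size (atoms psi))%N ->
  exists2 a, eval e (nth (Cst 0) (atoms psi) j) = Some a &
    `|dval R (theta (term_name phi j) (map frac_dyadic (map snd g)) k.+1) - a|
    < 2 ^- k.
Proof.
set sg := unit_subst _ _ => hg inst lt_j; have [ssg sz _] := inst.
have sg_size : size sg = size (qprefix phi) by rewrite size_unit_subst.
set t := nth (Cst 0) (atoms (matrix_of (unit_sentence phi))) j.
have Et : t = tsubst sg (nth (Cst 0) (atoms psi) j).
  by rewrite /t atoms_msubst (nth_map (Cst 0)).
pose f := @NamedFun R (term_name phi j) (size (qprefix phi))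
  (fun x => eval x t).
have hf : terms_of S f.
  by exists phi, j; split=> //; rewrite atoms_msubst size_map.
have sx : size (map fst g) == size (qprefix phi).
  by rewrite sz -ssg sg_size.
have sd' : size (map frac_dyadic (map snd g)) == size (qprefix phi).
  by rewrite !size_map -(size_map fst).
pose x : (size (qprefix phi)).-tuple R := Tuple sx.
pose d : (size (qprefix phi)).-tuple dyadic := Tuple sd'.
have hgl (l : 'I_(size (qprefix phi))) :
    [/\ tracks eps (nth (0, [::]) g l), tnth x l = (nth (0, [::]) g l).1 &
        tnth (point R d) l = frac_value R (nth (0, [::]) g l).2].
  have lt_l : (l < size g)%N by rewrite -(size_map fst) (eqP sx).
  split.
  - by apply: (allP hg); apply: mem_nth.
  - by rewrite (tnth_nth 0) /= (nth_map (0, [::])).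
  - by rewrite (tnth_nth 0) /= -!map_comp (nth_map (0, [::])).
have cx : in_cube x by move=> l; have [/andP[? _] -> _] := hgl l.
have cd : in_cube (point R d).
  move=> l; have [_ _ ->] := hgl l.
  by rewrite frac_value_ge0 ltW ?frac_value_lt1.
case Ea: (nf_fun f x) (@htotal f hf x cx) => [a|] // _.
case Eb: (nf_fun f (point R d)) (@htotal f hf _ cd) => [b|] // _.
exists a.
  rewrite -(eval_term_subst inst) -?Et //.
  have /andP[_ /(all_nthP (Cst 0)) hv] := hphi.
  by rewrite sg_size; apply: hv.
have hab : `|a - b| < 2 ^- k.+1.
  apply: (@hmod f hf k.+1 x (point R d) a b cx cd Ea Eb) => l.
  have [/andP[_ h] -> ->] := hgl l.
  (* The polynomial [m] is monotone, so the precision for the longest possible name suffices for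
     this one. *)
  apply: lt_le_trans h _; rewrite lef_pV2 ?posrE ?exprn_gt0 //.
  rewrite ler_eXn2l ?ltr1n // horner_nat_le // leq_add2r.
  exact: size_term_name.
have hb := @happrox f hf d k.+1 b cd Eb.
have -> : (2 ^- k : R) = 2 ^- k.+1 + 2 ^- k.+1.
  by rewrite exprS invfM; field; rewrite expf_neq0 // pnatr_eq0.
rewrite -[_ - a](subrKA b); apply: le_lt_trans (ler_normD _ _) _.
by rewrite ler_ltD // distrC.
Qed.

Variables (O : word -> word) (dlt : rat).
Hypothesis hO : oracle_of theta O.
Hypothesis hk : 2 ^- k <= ratr dlt / 2 :> R.

Lemma answers_sound g e :
  all (tracks eps) g ->
  instance (map fst g) (unit_subst (qprefix phi) [::]) e ->
  mvalue (atom_answer O k phi (map snd g)) 0 psi -> matrix_holds e psi.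
Proof.
move=> hg inst; apply: mvalue_holds => j lt_j.
have [a Ea ha] := atom_approx hg inst lt_j; exists a => //.
rewrite /atom_answer hO (accepted_dyadic R).
by move: ha; rewrite ltr_norml; lra.
Qed.

Lemma answers_complete g e :
  all (tracks eps) g ->
  instance (map fst g) (unit_subst (qprefix phi) [::]) e ->
  matrix_holds e (strengthen_matrix dlt psi) ->
  mvalue (atom_answer O k phi (map snd g)) 0 psi.
Proof.
move=> hg inst; apply: holds_mvalue => j a lt_j Ea hda.
have [a' Ea' ha] := atom_approx hg inst lt_j.
move: Ea' ha; rewrite Ea => -[<-]; rewrite ltr_norml => ha.
by rewrite /atom_answer hO (accepted_dyadic R); move: ha hk; lra.
Qed.

End Approximation.

Theorem theorem37 (R : realType) (F : signature R)
  (hF : computable_signature F)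
  (C : fun_family R -> Prop)
  (hP : forall A : fun_family R, P_C01 A -> C A)
  (hPSPACE : forall A : fun_family R, C A -> PSPACE_C01 A)
  (S : sentence F -> Prop)
  (hS : forall phi, S phi -> bounded_sentence phi)
  (hSC : C (terms_of S))
  (n : nat) (dlt : rat) (hdlt : 0 < dlt) :
  SigmaP_rel n C
    (delta_decision dlt (fun phi => S phi /\ Sigma_sentence n phi)).
Proof.
exists (terms_of S); split=> //.
(* The modulus is a property of the functions, so this polynomial one remains valid for every
   representation that the oracle may offer. *)
have [m [theta0 [[_ hmod _] _]]] := hPSPACE _ hSC.
have [k hk] : exists k, 2 ^- k <= ratr dlt / 2 :> R.
  by apply: exists_small_power; rewrite divr_gt0 // ltr0q.
(* The extra digit turns the weak bound of [frac_value_dense] into the strict one required by the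
   modulus. *)
pose L x := (precision m k x + 1)%N.
(* A sentence of length [x] has at most [x] quantifiers, each taking at most [2 * L x + 1] bits of a
   packed word. *)
have [p hp] : is_polynomial (fun x => x * (2 * L x + 1))%N.
  apply: polynomialM; first exact: polynomial_id.
  apply: polynomialD; last exact: polynomial_const.
  apply: polynomialM; first exact: polynomial_const.
  apply: polynomialD; last exact: polynomial_const.
  by apply: polynomial_comp; repeat first
    [ exact: polynomial_const | exact: polynomial_id
    | apply: polynomialD | apply: polynomialM ].
(* Seven tapes beyond the three of every machine make the ten stacks. *)
exists (compile 7 (decide k)), p => m' theta O [htot _ happ] hO.
split.
  have [q hq] := polynomial_time_bound k; exists q => w.
  have [h _] := @compile_outputs 7 (decide k) O w 9 (wf_decide k).
  by rewrite (halted_run h) // -hq; apply: cost_decide.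
move=> phi [Sphi [kk Ekk]].
have [hcl hint] := hS _ Sphi.
set x := enc_sentence phi.
pose T us : Prop := mvalue (atom_answer O k phi us) 0 (matrix_of phi).
have hb : (size (flags kk 0 n) * (2 * L (size x) + 1)
           <= p.[size x])%N.
  rewrite -hp leq_mul2r -[size (flags _ _ _)](congr1 size Ekk) size_map.
  by rewrite (leq_trans (leq_addr _ _) (size_sentence phi)) orbT.
have heps : 2 ^- L (size x) < 2 ^- precision m k (size x) :> R.
  by rewrite ltf_pV2 ?posrE ?exprn_gt0 // ltr_eXn2l ?ltr1n // /L addn1.
have inst0 : @instance R F (map fst (Nil (R * word))) [::] [::] by split.
have /andP[hpre _] := hcl.
split=> [hL|nL hstr].
  have fin := answers_sound htot hmod happ Sphi hcl hO (k := k).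
  apply: (@word_game_sound _ _ _ _ heps T _ _ fin _ _ [::] _
    erefl inst0 isT hpre hint).
  rewrite Ekk; apply: (@alternation_word_game T kk _ _ n 0 [::] [::] [::]) hb _.
  apply: alternation_ext hL => zs /accepts_decide.
  by rewrite /T Ekk drop0.
apply: nL; rewrite /SigmaP_language.
have hw : word_game T (fun u => (size u <= L (size x))%N) (fun=> True)
    (flags kk 0 n) [::].
  rewrite -[flags _ _ _]Ekk.
  have fin := answers_complete htot hmod happ Sphi hcl hO hk.
  exact: (word_game_complete heps fin erefl inst0 isT hpre hint hstr).
have := @word_game_alternation T kk _ _ n 0 [::] [::] [::] hb hw.
apply: alternation_ext => zs; rewrite /= drop0 => h.
by apply/accepts_decide; move: h; rewrite /T Ekk.
Qed.
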